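(* The sequence $(p(2,n))_{n\ge 1}$ satisfies Benford's Law in every integer base $b\ge 2$.
   Context: $p(2,n)$ denotes the number of partitions of the $2\times n$ rectangle: multisets of rectangular blocks with positive integer side lengths (a block of size $k\times l$ being indistinguishable from one of size $l\times k$, i.e. blocks may be rotated by 90 degrees) that can be arranged to cover exactly the $2\times n$ rectangle with pairwise disjoint interiors; two partitions are the same if they are equal as multisets. For a sequence $(a_n)_{n\ge1}$ of positive integers, a base $b\ge2$ and a string of base-$b$ digits $f=f_0f_1\cdots f_{t-1}$ with $f_i\in\{0,1,\ldots,b-1\}$ and $f_0\ne0$, put $$B_a(f,b;x):=\frac{|\{1\le n\le x:\ a_n \text{ in base } b \text{ begins with the string } f\}|}{x},$$ and identify $f$ with the integer $f_0b^{t-1}+f_1b^{t-2}+\cdots+f_{t-1}$. The sequence $(a_n)$ satisfies Benford's Law in base $b$ if for every such string $f$, $$\lim_{x\to\infty}B_a(f,b;x)=\log_b(f+1)-\log_b(f).$$ *)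

(* Defs.v *)
From HB Require Import structures.
From mathcomp Require Import all_boot all_order all_algebra.
From mathcomp Require Import finmap multiset.
From mathcomp Require Import all_classical all_reals all_analysis.
Import Order.TTheory GRing.Theory Num.Theory.
Import numFieldNormedType.Exports.

Set Implicit Arguments.
Unset Strict Implicit.
Unset Printing Implicit Defensive.

(* The m x n rectangle is the set of its unit cells 'I_m * 'I_n, and a placed
   block is the set of cells it covers.  Integer positions are no restriction:
   in a tiling by blocks with integer sides, the left edge of a block lies on
   the boundary or against the right edge of another block, so by induction all
   coordinates are integers. *)
Definition is_block m n (B : {set 'I_m * 'I_n}) : bool :=
  [exists c : 'I_m * 'I_n, exists d : 'I_m * 'I_n,
    B == [set x : 'I_m * 'I_n | (c.1 <= x.1 <= d.1)%N && (c.2 <= x.2 <= d.2)%N]].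

(* [finset.partition] also requires the blocks to be nonempty. *)
Definition tilings m n : {set {set {set 'I_m * 'I_n}}} :=
  [set P | finset.partition P [set: 'I_m * 'I_n] & [forall B in P, is_block B]].

Definition block_height m n (B : {set 'I_m * 'I_n}) : nat :=
  #|[set x.1 | x in B]|.

Definition block_width m n (B : {set 'I_m * 'I_n}) : nat :=
  #|[set x.2 | x in B]|.

(* Sorting the two sides identifies a k x l block with an l x k block. *)
Definition block_size m n (B : {set 'I_m * 'I_n}) : nat * nat :=
  (minn (block_height B) (block_width B),
   maxn (block_height B) (block_width B)).

Definition block_mset m n (P : {set {set 'I_m * 'I_n}}) : {mset nat * nat}%mset :=
  seq_mset [seq block_size B | B <- enum P].

Definition rect_partitions m n : {fset {mset nat * nat}%mset}%fset :=
  [fset block_mset P | P in tilings m n]%fset.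

Definition rect_partition_number m n : nat := #|` rect_partitions m n|%fset.

(* Base-b digits, most significant first; meaningful for 1 < b and 0 < n. *)
Definition digits (b n : nat) : seq nat :=
  [seq (n %/ b ^ i %% b)%N | i <- rev (iota 0 (trunc_log b n).+1)].

Definition digit_string (b : nat) (f : seq nat) : bool :=
  all (fun d => (d < b)%N) f && (head 0%N f != 0%N).

Definition string_value (b : nat) (f : seq nat) : nat :=
  foldl (fun v d => (v * b + d)%N) 0%N f.

Local Open Scope classical_set_scope.
Local Open Scope ring_scope.

(* Here x is real: for 0 <= x, the integers n with 1 <= n <= x are those
   with 1 <= n <= Num.truncn x. *)
Definition leading_freq (R : realType) (a : nat -> nat) (f : seq nat) (b : nat)
    (x : R) : R :=
  (count (fun n => prefix f (digits b (a n))) (iota 1 (Num.truncn x)))%:R / x.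

Definition logb (R : realType) (b : nat) (y : R) : R := ln y / ln b%:R.

(* Only the values a n with 1 <= n matter. *)
Definition benford (R : realType) (a : nat -> nat) (b : nat) : Prop :=
  forall f : seq nat, digit_string b f ->
    leading_freq a f b x @[x --> +oo] -->
      (logb b (string_value b f).+1%:R - logb b (string_value b f)%:R : R).

(* Main.v *)
Require Import Defs.
From mathcomp Require Import all_boot all_order all_algebra.
From mathcomp Require Import all_classical all_reals all_analysis.
From mathcomp Require Import finmap multiset.
From mathcomp Require Import zify ring lra.

(** Write A(n) for the number of partitions of the 2 x n rectangle.  Benford's
    law for A in every base follows from the single limit
      sqrt n * (1 - A(n-1) / A(n)) --> kap > 0
    ([rect_partition_number_ratio]).  Indeed f(n) = log_b A(n) then has
    increments equivalent to a constant over sqrt n: they tend to 0 but sum to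
    infinity slowly enough for the fractional parts of f(n) - c to have mean 1/2
    for every c ([mean_frac_cvg]).  The indicator of a leading string of value v
    is a difference of two integer parts of f(n) minus a constant, so its mean is
    the difference log_b(v+1) - log_b(v) of the constants
    ([benford_of_sqrt_growth]).

    Combinatorics.  In a tiling, the blocks of height 2 may be moved to the left,
    and the blocks of height 1 then fill the two rows independently.  So a
    multiset of blocks consists of a partition of some j into parts at least 2
    (the 2 x k blocks with k >= 2) and of a partition of 2(n-j) whose parts can
    be shared equally between two rows, some of the parts 2 possibly standing
    upright across both.  Hence A is the convolution of D, the number of
    partitions into parts at least 2, and of Q, the number of such splittable
    partitions ([rect_partition_number_conv]).  As D is the first difference of
    the partition function p, A is also the convolution of p and of the
    increments w of Q, and A(n)/A(n-1) is governed by averages of p(j)/p(j-1).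

    Growth of p.  Logarithmic differentiation of the generating product gives
    n p(n) = sum_k sigma(k) p(n-k), and sigma(1) + ... + sigma(k) is equivalent
    to C k^2 / 2.  Because D is nondecreasing (increase the largest part), a
    summation by parts shows n D(n) ~ C y(n) where y(n) = p(0) + ... + p(n).
    This is a discrete form of y'' = C y / n, whose energy n y'^2 - C y^2 is
    negligible: the Stolz-Cesaro theorem yields n p(n)^2 ~ C y(n)^2, and
    therefore sqrt n * D(n) / p(n) --> lam = sqrt C ([npart_ratio]) and
    ln p(n) ~ 2 lam sqrt n.

    Concentration.  A greedy distribution of the parts, corrected by adding parts
    equal to 1, shows ln Q(m) ~ ln p(2m).  So the terms p(j) w(n-j) behave at
    most like exp(2 lam (sqrt j + sqrt(2(n-j)))) while A(n) is as large as the
    maximum exp(2 lam sqrt(3n)) of this expression, up to exp(o(sqrt n)).  The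
    maximum is at j = n/3 and is strict, so the other j are negligible, and
    kap = sqrt 3 * lam ([rect_increment_approx]). *)

Set Implicit Arguments.
Unset Strict Implicit.
Unset Printing Implicit Defensive.

(** * Partitions of an integer as decreasing lists *)

(** The recursion lowers either K or n, so any number above K + n is enough
    fuel. *)
Fixpoint parts_rec (fuel K n : nat) : seq (seq nat) :=
  if fuel is f.+1 then
    if n == 0 then [:: [::]]
    else if K is K'.+1 then
      parts_rec f K' n ++
      (if K <= n then [seq K :: s | s <- parts_rec f K (n - K)] else [::])
    else [::]
  else [::].

Definition partitions_le (K n : nat) : seq (seq nat) := parts_rec (K + n).+1 K n.

Lemma mem_parts_rec fuel K n s : K + n < fuel ->
  (s \in parts_rec fuel K n) = [&& path geq K s, 0 \notin s & sumn s == n].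
Proof.
elim: fuel K n s => [|f IH] K n s //= ltKn.
have [->|n0] := eqVneq n 0.
  rewrite inE; apply/eqP/idP => [-> //|/and3P[_ s0 /eqP]].
  by case: s s0 => // x s; rewrite inE /= => + xs; rewrite (_ : x = 0) //; lia.
case: K ltKn => [|K] ltKn.
  rewrite in_nil; apply/esym/negbTE/negP => /and3P[].
  case: s => [_ _ /=|x s]; first by lia.
  by rewrite /= inE leqn0 eq_sym => /andP[->].
rewrite mem_cat IH; last by lia.
have -> : (s \in (if K < n then [seq K.+1 :: s0 | s0 <- parts_rec f K.+1 (n - K.+1)] else [::]))
   = [&& head 0 s == K.+1, path geq K.+1 s, 0 \notin s & sumn s == n].
  case: s => [|x s]; first by case: ifP => // _; apply/mapP => -[].
  rewrite /= inE negb_or.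
  have [->|xK] := eqVneq x K.+1; last first.
    case: ifP => // _; apply/mapP => -[? _ [xE _]].
    by rewrite xE eqxx in xK.
  rewrite leqnn /=; case: ltnP => Kn.
    rewrite mem_map => [|u v [] //]; rewrite IH; last by lia.
    by congr [&& _ , _ & _]; lia.
  by apply/esym/negbTE/negP => /and3P[]; lia.
case: s => [|x s]; first by rewrite /= orbF.
rewrite /=.
have [->|xK] := eqVneq x K.+1; first by rewrite ltnn leqnn.
by rewrite orbF /geq /= [x <= K.+1]leq_eqVlt (negbTE xK) ltnS.
Qed.

Lemma mem_partitions_le K n s :
  (s \in partitions_le K n) = [&& path geq K s, 0 \notin s & sumn s == n].
Proof. exact: mem_parts_rec. Qed.

Lemma uniq_partitions_le K n : uniq (partitions_le K n).
Proof.
suff H f : K + n < f -> uniq (parts_rec f K n) by exact: H.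
elim: f K n => [|f IH] K n //= ltKn.
case: eqVneq => // _; case: K ltKn => // K ltKn.
rewrite cat_uniq IH /=; last by lia.
apply/andP; split; last first.
  case: ifP => // Kn; rewrite map_inj_uniq; last by move=> u v [].
  by apply: IH; lia.
apply/hasPn => s; case: ifP => // Kn /mapP[s' _ ->].
rewrite mem_parts_rec /=; last by lia.
by rewrite ltnn.
Qed.

Definition npart_le (K n : nat) : nat := size (partitions_le K n).

Lemma npart_0le n : npart_le 0 n = (n == 0).
Proof. by rewrite /npart_le /partitions_le /=; case: eqP. Qed.

(** Either no part equals K + 1, or one such part can be removed. *)
Lemma npart_leS K n :
  npart_le K.+1 n = npart_le K n + (if K < n then npart_le K.+1 (n - K.+1) else 0).
Proof.
have [Kn|nK] := ltnP K n.
  rewrite /npart_le -(size_map (cons K.+1) (partitions_le _ (n - _))) -size_cat.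
  apply/perm_size/uniq_perm; rewrite ?uniq_partitions_le //.
    rewrite cat_uniq uniq_partitions_le map_inj_uniq ?uniq_partitions_le /=; last by move=> ? ? [].
    rewrite andbT; apply/hasPn => s /mapP[t _ ->].
    by rewrite mem_partitions_le /= ltnn.
  move=> [|x s]; rewrite mem_cat !mem_partitions_le /=.
    by rewrite -[RHS]/(_ || _); case: eqP => [|_]; [lia | rewrite /=; apply/esym/mapP => -[]].
  have [->|xK] := eqVneq x K.+1.
    rewrite mem_map => [|u v [] //]; rewrite mem_partitions_le leqnn ltnn /=.
    by rewrite inE /=; congr [&& _ , _ & _]; lia.
  have /negbTE -> : x :: s \notin [seq K.+1 :: t | t <- partitions_le K.+1 (n - K.+1)].
    by apply/mapP => -[? _ [xE _]]; rewrite xE eqxx in xK.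
  rewrite orbF.
  by rewrite /geq /= [x <= K.+1]leq_eqVlt (negbTE xK) ltnS.
rewrite addn0; apply/perm_size/uniq_perm; rewrite ?uniq_partitions_le //.
move=> [|x s]; rewrite !mem_partitions_le //=.
rewrite /geq /=; apply/idP/idP => /and3P[/andP[xK ->] -> /eqP xs]; rewrite !andbT /=; lia.
Qed.

Definition npart (n : nat) : nat := npart_le n n.

Lemma npart_leE K n : n <= K -> npart_le K n = npart n.
Proof.
elim: K => [|K IH]; first by rewrite leqn0 => /eqP ->.
rewrite leq_eqVlt => /orP[/eqP -> //|nK].
by rewrite npart_leS ltnNge -ltnS nK /= addn0 IH.
Qed.

Lemma npart_le_mono n : {homo npart_le^~ n : K L / K <= L}.
Proof.
move=> K0 L; elim: L => [|L IH]; first by rewrite leqn0 => /eqP ->.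
rewrite leq_eqVlt => /orP[/eqP -> //|/IH h].
by apply: leq_trans h _; rewrite npart_leS leq_addr.
Qed.

Lemma npart_le_le K n : npart_le K n <= npart n.
Proof.
have [/npart_leE -> //|/ltnW] := leqP n K.
exact: npart_le_mono.
Qed.

Definition partitions_ge2 (n : nat) : seq (seq nat) :=
  [seq xs <- partitions_le n n | 1 \notin xs].

Definition npart_ge2 (n : nat) : nat := size (partitions_ge2 n).

(** Deleting a part 1 matches the partitions of n + 1 containing a 1 with all
    partitions of n. *)
Lemma npartS n : npart n.+1 = npart n + npart_ge2 n.+1.
Proof.
rewrite /npart /npart_ge2 /partitions_ge2 /npart_le -(count_predC (fun s => 1 \in s) (partitions_le n.+1 _)).
rewrite [size (seq.filter _ _)]size_filter; congr (_ + _).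
rewrite -size_filter -(size_map (rcons^~ 1)); apply/perm_size/uniq_perm.
- by rewrite filter_uniq ?uniq_partitions_le.
- by rewrite map_inj_uniq ?uniq_partitions_le // => u v /rcons_inj[].
move=> s; rewrite mem_filter mem_partitions_le; apply/idP/mapP.
  move=> /and4P[s1 sn s0 /eqP ss].
  have [s' sE] : exists s', s = rcons s' 1.
    have := path_sorted sn; rewrite -rev_sorted.
    case/lastP: s s1 s0 {sn ss} => // s' x; rewrite rev_rcons !mem_rcons !inE /=.
    rewrite negb_or => s1 /andP[x0 _] /(order_path_min leq_trans)/allP xs.
    exists s'; congr rcons; apply/eqP; rewrite eqn_leq lt0n eq_sym x0 andbT.
    by case/orP: s1 => [/eqP <- //|s1]; apply: xs; rewrite mem_rev.
  exists s' => //; rewrite mem_partitions_le.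
  move: sn s0 ss; rewrite sE rcons_path mem_rcons inE /= sumn_rcons addn1 => /andP[+ _] -> /eqP.
  rewrite eqSS => ps /[dup] /eqP sn ->; rewrite andbT /=.
  by case: s' ps sn {sE} => //= x s' /andP[_ ->] <-; rewrite /geq /= leq_addr.
move=> [t + ->]; rewrite mem_partitions_le mem_rcons inE /= => /and3P[pt t0 /eqP tn].
rewrite mem_rcons inE /= t0 sumn_rcons tn addn1 eqxx !andbT rcons_path.
apply/andP; split.
  by case: t pt {t0 tn} => //= x t /andP[xn ->]; rewrite andbT; apply: leq_trans xn _.
case/lastP: t t0 {pt tn} => //= t x; rewrite last_rcons mem_rcons inE negb_or => /andP[x0 _].
by rewrite /geq /= lt0n eq_sym.
Qed.

Lemma npart_mono : {homo npart : m n / m <= n}.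
Proof.
move=> m; elim=> [|n IH]; first by rewrite leqn0 => /eqP ->.
rewrite leq_eqVlt => /orP[/eqP -> //|/IH h].
by apply: leq_trans h _; rewrite npartS leq_addr.
Qed.

(** Union bound: removing a part k > r leaves a partition of n - k, and
    npart (n - k) <= npart (n - r). *)
Lemma npart_le_ge r n : npart n <= npart_le r n + n * npart (n - r).
Proof.
suff H K : npart_le K n <= npart_le r n + (K - r) * npart (n - r).
  by apply: leq_trans (H n) _; rewrite leq_add2l leq_mul2r leq_subr orbT.
have [/npart_le_mono h|] := leqP K r; first exact: leq_trans (h n) (leq_addr _ _).
elim: K => // K IH; rewrite ltnS => rK.
have {}IH : npart_le K n <= npart_le r n + (K - r) * npart (n - r).
  move: rK; rewrite leq_eqVlt => /orP[/eqP -> |/IH//]; exact: leq_addr.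
rewrite npart_leS subSn // mulSn addnCA addnC; apply: leq_add IH.
case: ifP => // _; apply: leq_trans (npart_le_le _ _) (npart_mono _).
by apply: leq_sub2l; apply: leqW.
Qed.

(** Increasing the largest part by one is injective and creates no part 1.  This
    is the convexity of [npart], the regularity on which its asymptotics rest. *)
Lemma npart_ge2_mono n : 0 < n -> npart_ge2 n <= npart_ge2 n.+1.
Proof.
move=> n0; rewrite /npart_ge2 /partitions_ge2 -(size_map (fun s => (head 0 s).+1 :: behead s) [seq _ <- _ | _]).
apply: uniq_leq_size.
  rewrite map_inj_in_uniq; first by rewrite filter_uniq ?uniq_partitions_le.
  move=> u v; rewrite !mem_filter !mem_partitions_le => /and4P[_ _ _ u0] /and4P[_ _ _ v0].
  case: u u0 => [|x u]; first by rewrite /=; lia.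
  case: v v0 => [|y v]; first by rewrite /=; lia.
  by move=> _ _ [-> ->].
move=> t /mapP[s + ->]; rewrite !mem_filter !mem_partitions_le.
case: s => [|x s] /=; first by lia.
move=> /and4P[+ /andP[xn ps] + /eqP <-].
rewrite !inE !negb_or => /andP[x1 ->] /andP[x0 ->].
rewrite addSn eqxx !andbT /geq /= ltnS leq_addr /= ?andbT; apply/andP; split; first by lia.
by case: s ps => //= y s /andP[xy ->]; rewrite andbT; apply: leqW.
Qed.

(** * Tilings of the two-row rectangle *)

(** Verifying a tiling becomes a count: a set listed twice, or two sets that
    meet, would cover some point twice. *)
Lemma exact_cover (T : finType) (L : seq {set T}) : finset.set0 \notin L ->
  (forall x, count (fun B : {set T} => x \in B) L = 1) ->
  uniq L /\ finset.partition [set B | B \in L] [set: T].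
Proof.
move=> L0 L1.
have two A B L' : perm_eq L (A :: B :: L') -> forall x, x \in A -> x \notin B.
  move=> /permP pL x xA; apply/negP => xB.
  by have := L1 x; rewrite pL /= xA xB.
have uL : uniq L.
  apply/negbNE/negP => /(uniqPn finset.set0) [i [j [ij jL E]]].
  pose A := nth finset.set0 L i.
  have AL : A \in L by apply: mem_nth; apply: ltn_trans jL.
  have [x xA] : exists x, x \in A by apply/set0Pn; apply: contraNneq L0 => <-.
  have : 1 < count_mem A L.
    rewrite -(cat_take_drop j L) count_cat (drop_nth finset.set0) //= -E eqxx.
    have : A \in take j L by rewrite /A -(nth_take finset.set0 ij) mem_nth // size_take jL.
    by rewrite -has_pred1 has_count => h; apply: (@leq_add 1 1).
  have : count_mem A L <= count (fun B : {set T} => x \in B) L.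
    by apply: sub_count => B /eqP ->.
  by rewrite L1; lia.
split=> //; apply/and3P; split; [ | | by rewrite inE].
- rewrite finset.eqEsubset finset.subsetT; apply/fintype.subsetP => x _.
  have /hasP[B BL xB] : has (fun B : {set T} => x \in B) L by rewrite has_count L1.
  by apply/bigcupP; exists B; rewrite ?inE.
- apply/finset.trivIsetP => A B; rewrite !inE => AL BL AB.
  have BL' : B \in rem A L by rewrite (mem_rem_uniq _ uL) !inE eq_sym AB.
  have pL : perm_eq L (A :: B :: rem B (rem A L)).
    by apply: perm_trans (perm_to_rem AL) _; rewrite perm_cons perm_to_rem.
  by rewrite disjoint_subset; apply/fintype.subsetP => x /(two _ _ _ pL); rewrite inE.
Qed.

Section TwoRowTilings.
Variable n : nat.
Local Notation cell := ('I_2 * 'I_n)%type.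

Definition placed_block (r1 r2 : nat) (s : nat * nat) : {set cell} :=
  [set x : cell | (r1 <= x.1 <= r2) && (s.1 <= x.2 < s.1 + s.2)].

(** The pairs are (first column, width). *)
Fixpoint segments (o : nat) (ws : seq nat) : seq (nat * nat) :=
  if ws is w :: ws' then (o, w) :: segments (o + w) ws' else [::].

Lemma map_segments o ws : map snd (segments o ws) = ws.
Proof. by elim: ws o => //= w ws IH o; rewrite IH. Qed.

Lemma count_segments o ws c :
  count (fun s => s.1 <= c < s.1 + s.2) (segments o ws) = (o <= c < o + sumn ws).
Proof.
elim: ws o => [|w ws IH] o /=; first by rewrite addn0; lia.
by rewrite IH; lia.
Qed.

Lemma segments_bounds o ws s : 0 \notin ws -> s \in segments o ws ->
  [/\ 0 < s.2 & s.1 + s.2 <= o + sumn ws].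
Proof.
elim: ws o => //= w ws IH o; rewrite !inE negb_or => /andP[w0 /IH{}IH].
by case/orP=> [/eqP -> /=|/IH[]]; lia.
Qed.

Lemma card_ord_interval m c w : c + w <= m -> #|[set i : 'I_m | c <= i < c + w]| = w.
Proof.
move=> cm; have lt (i : 'I_w) : c + i < m by have := ltn_ord i; lia.
rewrite -[RHS]card_ord -(card_imset _ (f := fun i => Ordinal (lt i))); last first.
  by move=> i j /(congr1 val) /= /addnI /val_inj.
apply: eq_card => j; rewrite inE; apply/idP/imsetP => [/andP[cj jw]|[i _ ->] /=].
  have iw : j - c < w by lia.
  by exists (Ordinal iw) => //; apply/val_inj => /=; lia.
by have := ltn_ord i; lia.
Qed.

Lemma placed_block_rect r1 r2 s : r1 <= r2 < 2 -> 0 < s.2 -> s.1 + s.2 <= n ->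
  [/\ is_block (placed_block r1 r2 s), placed_block r1 r2 s != finset.set0 &
     block_size (placed_block r1 r2 s) =
       (minn (r2 - r1).+1 s.2, maxn (r2 - r1).+1 s.2)].
Proof.
case: s => c w /= /andP[r12 r22] w0 cn.
have r1P : r1 < 2 by lia.
have cP : c < n by lia.
have dP : c + w.-1 < n by lia.
set B := placed_block _ _ _.
have inB i j (ri : r1 <= i <= r2) (cj : c <= j < c + w) (iP : i < 2) (jP : j < n) : (Ordinal iP, Ordinal jP) \in B.
  by rewrite inE /= ri.
split.
- apply/existsP; exists (Ordinal r1P, Ordinal cP); apply/existsP; exists (Ordinal r22, Ordinal dP).
  by apply/eqP/setP => x; rewrite !inE /=; congr (_ && _); lia.
- by apply/set0Pn; exists (Ordinal r1P, Ordinal cP); apply: inB; lia.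
rewrite /block_size /block_height /block_width.
have -> : [set x.1 | x in B] = [set i : 'I_2 | r1 <= i < r1 + (r2 - r1).+1].
  apply/setP => i; rewrite !inE; apply/imsetP/idP => [[x + ->]|ri]; first by rewrite inE /=; lia.
  exists (i, Ordinal cP) => //; rewrite inE /=; lia.
have -> : [set x.2 | x in B] = [set j : 'I_n | c <= j < c + w].
  apply/setP => j; rewrite !inE; apply/imsetP/idP => [[x + ->]|rj]; first by rewrite inE /=; lia.
  exists (Ordinal r1P, j) => //; rewrite inE /=; lia.
by rewrite !card_ord_interval //; lia.
Qed.

(** For k = 1 this is the vertical 1 x 2 block. *)
Definition size_full (k : nat) := (minn 2 k, maxn 2 k).

(** The blocks of full height are laid first, from left to right; the two rows
    of the remaining rectangle are then filled independently. *)
Lemma tiling_of_widths xs us vs :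
  [/\ 0 \notin xs, 0 \notin us & 0 \notin vs] ->
  sumn xs + sumn us = n -> sumn xs + sumn vs = n ->
  exists2 P, P \in tilings 2 n &
    perm_eq [seq block_size B | B <- enum P]
      (map size_full xs ++ map (pair 1) us ++ map (pair 1) vs).
Proof.
move=> [x0 u0 v0] xu xv.
pose L := map (placed_block 0 1) (segments 0 xs) ++
  map (placed_block 0 0) (segments (sumn xs) us) ++
  map (placed_block 1 1) (segments (sumn xs) vs).
have bd r1 r2 o ws B : r1 <= r2 < 2 -> 0 \notin ws -> o + sumn ws <= n ->
    B \in map (placed_block r1 r2) (segments o ws) -> is_block B /\ B != finset.set0.
  move=> r12 w0 wn /mapP[s sw ->]; have [s0 sn] := segments_bounds w0 sw.
  by have [] := placed_block_rect r12 s0 (leq_trans sn wn).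
have LP B : B \in L -> is_block B /\ B != finset.set0.
  rewrite !mem_cat => /or3P[] /bd; apply => //; lia.
have sz r1 r2 o ws : r1 <= r2 < 2 -> 0 \notin ws -> o + sumn ws <= n ->
    map (@block_size 2 n) (map (placed_block r1 r2) (segments o ws)) =
    map (fun w => (minn (r2 - r1).+1 w, maxn (r2 - r1).+1 w)) ws.
  move=> r12 w0 wn; rewrite -[in RHS](map_segments o ws) -!map_comp.
  apply/eq_in_map => s sw /=; have [s0 sn] := segments_bounds w0 sw.
  by have [] := placed_block_rect r12 s0 (leq_trans sn wn).
have cnt r1 r2 o ws (x : cell) :
    count (fun B : {set cell} => x \in B) (map (placed_block r1 r2) (segments o ws)) =
    (r1 <= x.1 <= r2) && (o <= x.2 < o + sumn ws).
  rewrite count_map; case: (boolP (r1 <= x.1 <= r2)) => rx /=.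
    rewrite -count_segments; by apply: eq_count => s /=; rewrite inE rx.
  by rewrite (eq_count (a2 := pred0)) ?count_pred0 // => s /=; rewrite inE (negbTE rx).
have [] := @exact_cover _ L.
- by apply/negP => /LP[_]; rewrite eqxx.
- move=> [[i i2] [j jn]]; rewrite !count_cat !cnt /=; lia.
move=> uL pL; exists [set B | B \in L].
  rewrite inE pL /=; apply/'forall_implyP => B; rewrite inE => /LP[] //.
have pe : perm_eq (enum [set B | B \in L]) L.
  by apply: uniq_perm; rewrite ?enum_uniq // => B; rewrite mem_enum inE.
apply: perm_trans (perm_map _ pe) _; rewrite !map_cat !sz //; try lia.
rewrite subnn subn0.
have one ws : 0 \notin ws -> map (fun w => (minn 1 w, maxn 1 w)) ws = map (pair 1) ws.
  move=> w0; apply/eq_in_map => w wws; have w1 : 0 < w.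
    by rewrite lt0n; apply: contraNneq w0 => <-.
  by congr pair; lia.
by rewrite !one.
Qed.

Section WidthsOfTiling.
Variable P : {set {set cell}}.
Hypothesis PT : P \in tilings 2 n.

Let rows (B : {set cell}) := [set x.1 | x in B].

Lemma block_rect B : B \in P -> B = finset.setX (rows B) [set x.2 | x in B].
Proof.
move: PT; rewrite inE => /andP[_ /'forall_implyP H] /H /existsP[c /existsP[d /eqP ->]].
apply/setP => x; rewrite !inE; apply/idP/andP => [xB|[]].
  by split; apply/imsetP; exists x; rewrite // inE.
move=> /imsetP[y + ->] /imsetP[z + ->]; rewrite !inE => /andP[-> _] /andP[_ ->] //.
Qed.

(** A block that meets a row covers as many of its cells as the block is wide. *)
Lemma row_width_sum (r : 'I_2) :
  \sum_(B in P | r \in rows B) block_width B = n.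
Proof.
have pP : finset.partition P [set: cell] by move: PT; rewrite inE => /andP[].
transitivity (\sum_(x in [set: cell]) (x.1 == r)); last first.
  rewrite (_ : \sum_(x in [set: cell]) (x.1 == r) = #|finset.setX [set r] [set: 'I_n]|).
    by rewrite cardsX cards1 cardsT card_ord mul1n.
  rewrite -sum1_card [RHS]big_mkcond /= [LHS]big_mkcond; apply: eq_bigr => x _.
  by rewrite !inE andbT; case: eqP.
rewrite (set_partition_big _ pP) /= big_mkcondr; apply: eq_bigr => B BP.
transitivity #|[set x in B | x.1 == r]|; last first.
  rewrite -sum1_card [RHS]big_mkcond /= [LHS]big_mkcond; apply: eq_bigr => x _.
  by rewrite inE; case: (x \in B) => //=; case: eqP.
have -> : [set x in B | x.1 == r] = finset.setX (rows B :&: [set r]) [set x.2 | x in B].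
  apply/setP => x; rewrite !inE {1}(block_rect BP) !inE.
  by rewrite andbAC.
rewrite cardsX; case: ifP => rB.
  by rewrite (finset.setIidPr _) ?finset.sub1set // cards1 mul1n.
suff -> : rows B :&: [set r] = finset.set0 by rewrite cards0 mul0n.
by apply/setP => i; rewrite !inE; case: eqP => [->|]; rewrite ?andbF // rB.
Qed.

Lemma block_nonempty B : B \in P -> exists x, x \in B.
Proof.
move=> BP; apply/set0Pn; move: PT; rewrite inE => /andP[/and3P[_ _ P0] _].
by apply: contraNneq P0 => <-.
Qed.

Lemma block_width_gt0 B : B \in P -> 0 < block_width B.
Proof.
move=> /block_nonempty[x xB]; rewrite card_gt0; apply/set0Pn; exists x.2.
by apply/imsetP; exists x.
Qed.

Lemma card_set_ord2 (A : {set 'I_2}) : #|A| = (ord0 \in A) + (ord_max \in A).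
Proof.
rewrite -sum1_card big_mkcond /= big_ord_recl big_ord1.
rewrite (_ : lift ord0 ord0 = ord_max :> 'I_2); last exact/val_inj.
by case: (_ \in _); case: (_ \in _).
Qed.

(** Converse of [tiling_of_widths]: the blocks are classified by the rows that
    they meet, and counting the cells of each row gives the two sums. *)
Lemma widths_of_tiling : exists xs us vs,
  [/\ [/\ 0 \notin xs, 0 \notin us & 0 \notin vs],
   sumn xs + sumn us = n, sumn xs + sumn vs = n &
   perm_eq [seq block_size B | B <- enum P]
      (map size_full xs ++ map (pair 1) us ++ map (pair 1) vs)].
Proof.
pose top (B : {set cell}) := ord0 \in rows B.
pose bot (B : {set cell}) := ord_max \in rows B.
pose W := map (@block_width 2 n).
have W0 a : 0 \notin W [seq B <- enum P | a B].
  apply/negP => /mapP[B + B0]; rewrite mem_filter mem_enum => /andP[_ /block_width_gt0].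
  by rewrite -B0.
have sumW a : sumn (W [seq B <- enum P | a B]) = \sum_(B in P | a B) block_width B.
  by rewrite sumnE big_map big_filter big_enum_cond.
exists (W [seq B <- enum P | top B && bot B]), (W [seq B <- enum P | top B && ~~ bot B]),
   (W [seq B <- enum P | ~~ top B && bot B]).
split; first by split; apply: W0.
- by rewrite !sumW; apply: etrans (row_width_sum ord0); rewrite [RHS](bigID bot) /=; congr (_ + _);
    apply: eq_bigl => B; rewrite andbA.
- rewrite !sumW; apply: etrans (row_width_sum ord_max); rewrite [RHS](bigID top) /=; congr (_ + _);
    by apply: eq_bigl => B; rewrite -andbA; congr (_ && _); rewrite andbC.
have bsz B : B \in P -> block_size B = (minn (top B + bot B) (block_width B), maxn (top B + bot B) (block_width B)).
  by rewrite /block_size /block_height card_set_ord2.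
have inF a B : B \in [seq B <- enum P | a B] -> a B /\ B \in P.
  by rewrite mem_filter mem_enum => /andP[].
rewrite /W -!map_comp.
have -> : [seq (size_full \o @block_width 2 n) B | B <- enum P & top B && bot B] =
   [seq block_size B | B <- enum P & top B && bot B].
  by apply/eq_in_map => B /inF[/andP[tB bB] BP]; rewrite bsz // tB bB.
have -> : [seq (pair 1 \o @block_width 2 n) B | B <- enum P & top B && ~~ bot B] =
   [seq block_size B | B <- enum P & top B && ~~ bot B].
  apply/eq_in_map => B /inF[/andP[tB bB] BP]; rewrite bsz // tB (negbTE bB) /=.
  by have := block_width_gt0 BP => w0; congr pair; lia.
have -> : [seq (pair 1 \o @block_width 2 n) B | B <- enum P & ~~ top B && bot B] =
   [seq block_size B | B <- enum P & ~~ top B && bot B].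
  apply/eq_in_map => B /inF[/andP[tB bB] BP]; rewrite bsz // bB (negbTE tB) /=.
  by have := block_width_gt0 BP => w0; congr pair; lia.
rewrite -!map_cat; apply: perm_map.
have -> : [seq B <- enum P | ~~ top B && bot B] = [seq B <- enum P | ~~ top B].
  apply/eq_in_filter => B; rewrite mem_enum => BP; case tB: (top B) => //=.
  have [x xB] := block_nonempty BP.
  have : 0 < #|rows B| by rewrite card_gt0; apply/set0Pn; exists x.1; apply/imsetP; exists x.
  by rewrite card_set_ord2 -/(top B) tB -/(bot B); case: (bot B).
rewrite catA -(perm_filterC top (enum P)) perm_cat2r.
rewrite -(perm_filterC bot [seq B <- enum P | top B]) -!filter_predI.
by apply: perm_cat; apply/permP => a; congr count; apply: eq_filter => B /=; congr (_ && _); rewrite andbC.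
Qed.
End WidthsOfTiling.
End TwoRowTilings.

(** * The multisets of blocks of a two-row rectangle *)

(** Here i is the number of 1 x 2 blocks that stand upright; us and vs are the
    lengths of the blocks that lie in the two rows. *)
Definition splittable (m : nat) (zs : seq nat) : Prop := exists i us vs,
  [/\ perm_eq zs (nseq i 2 ++ us ++ vs), i + sumn us = m & i + sumn vs = m].

Definition splittable_partitions (m : nat) : seq (seq nat) :=
  [seq zs <- partitions_le (m * 2) (m * 2) | `[< splittable m zs >]].

Definition nsplit (m : nat) : nat := size (splittable_partitions m).

Definition pieces_mset (t : seq nat * seq nat) : {mset nat * nat}%mset :=
  seq_mset (map (pair 2) t.1 ++ map (pair 1) t.2).

(** Canonical forms of the multisets of blocks: xs lists the k of the 2 x k
    blocks with k >= 2, and zs the k of the 1 x k blocks. *)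
Definition pieces (n : nat) : seq (seq nat * seq nat) :=
  [seq t | s <- iota 0 n.+1,
           t <- [seq (xs, zs) | xs <- partitions_ge2 s, zs <- splittable_partitions (n - s)]].

Lemma partition_sorted K n s : s \in partitions_le K n -> sorted geq s.
Proof. by rewrite mem_partitions_le => /and3P[/path_sorted]. Qed.

Lemma sort_partition s n : 0 \notin s -> sumn s = n -> sort geq s \in partitions_le n n.
Proof.
move=> s0 <-; rewrite mem_partitions_le mem_sort s0.
have pe : perm_eq (sort geq s) s by rewrite perm_sort.
have -> : sumn (sort geq s) = sumn s by apply: perm_sumn.
rewrite eqxx !andbT path_min_sorted; first by apply: sort_sorted => x y; exact: leq_total.
apply/allP => x; rewrite mem_sort /geq /= => /perm_to_rem /perm_sumn ->.
by rewrite /= leq_addr.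
Qed.

Lemma mem_partitions_ge2 n xs : 0 \notin xs -> 1 \notin xs -> sumn xs = n ->
  sort geq xs \in partitions_ge2 n.
Proof. by move=> x0 x1 xn; rewrite mem_filter mem_sort x1 sort_partition. Qed.

Lemma piecesP n t : reflect
  (exists s, [/\ s <= n, t.1 \in partitions_ge2 s & t.2 \in splittable_partitions (n - s)])
  (t \in pieces n).
Proof.
apply: (iffP allpairsPdep) => [[s [t' [sn /allpairsP[[xs zs] [/= xP zP ->]] ->]]]|[s [sn t1 t2]]].
  by exists s; split=> //; move: sn; rewrite mem_iota add0n ltnS.
exists s, t; rewrite mem_iota add0n ltnS sn; split=> //.
by apply/allpairsP; exists t; split=> //; case: t {t1 t2}.
Qed.

Lemma size_pieces n : size (pieces n) = \sum_(s < n.+1) npart_ge2 s * nsplit (n - s).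
Proof.
rewrite size_allpairs_dep sumnE big_map -[iota 0 _]/(index_iota 0 n.+1) big_mkord.
by apply: eq_bigr => s _; rewrite size_allpairs.
Qed.

Lemma uniq_pieces n : uniq (pieces n).
Proof.
apply: allpairs_uniq_dep; first exact: iota_uniq.
  move=> s _; apply: allpairs_uniq => [||[? ?] [? ?] _ _ [-> ->] //].
    by rewrite filter_uniq ?uniq_partitions_le.
  by rewrite filter_uniq ?uniq_partitions_le.
move=> [s t] [s' t'] /allpairsPdep[x [y [_ h eq1]]] /allpairsPdep[x' [y' [_ h' eq2]]] /= tt'.
have key u v : v \in [seq (xs, zs) | xs <- partitions_ge2 u, zs <- splittable_partitions (n - u)] ->
    sumn v.1 = u.
  move=> /allpairsP[[xs zs] [/= + _ ->]] /=.
  by rewrite mem_filter mem_partitions_le => /and4P[_ _ _ /eqP].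
pose val2 (p : {_ : nat & (seq nat * seq nat)%type}) := tagged p.
have sx : s = x := congr1 tag eq1; have ty : t = y := congr1 val2 eq1.
have sx' : s' = x' := congr1 tag eq2; have ty' : t' = y' := congr1 val2 eq2.
by rewrite -tt'; congr existT; rewrite sx sx' -(key _ _ h) -(key _ _ h') -ty -ty' tt'.
Qed.

Lemma pieces_mset_inj n : {in pieces n &, injective pieces_mset}.
Proof.
have fst_map k l (s : seq nat) : [seq p.2 | p <- [seq (k, x) | x <- s] & p.1 == l] =
    if k == l then s else [::].
  by elim: s => [|x s IH] /=; [case: eqP | case: eqP => kl /=; rewrite IH; case: eqP].
move=> [xs zs] [xs' zs'] /piecesP[s [_ /= xP zP]] /piecesP[s' [_ /= xP' zP']].
move=> /eq_seq_msetP /= pe.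
have key l : perm_eq (map snd [seq p <- [seq (2, x) | x <- xs] ++ [seq (1, x) | x <- zs] | p.1 == l])
   (map snd [seq p <- [seq (2, x) | x <- xs'] ++ [seq (1, x) | x <- zs'] | p.1 == l]).
  by apply: perm_map; apply: perm_filter.
have so (u v : seq nat) : sorted geq u -> sorted geq v -> perm_eq u v -> u = v.
  apply: sorted_eq => [x y z|x y]; first by rewrite /geq /= => h1 h2; apply: leq_trans h2 h1.
  by rewrite /geq /= andbC -eqn_leq => /eqP.
move: xP xP' zP zP'; rewrite !mem_filter => /andP[_ xP] /andP[_ xP'] /andP[_ zP] /andP[_ zP'].
congr pair; apply: so; rewrite ?(partition_sorted xP) ?(partition_sorted xP') ?(partition_sorted zP) ?(partition_sorted zP') //.
  by have := key 2; rewrite !filter_cat !map_cat !fst_map /= !cats0.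
by have := key 1; rewrite !filter_cat !map_cat !fst_map.
Qed.

Lemma sumn_filter1 xs : sumn xs = sumn [seq x <- xs | x != 1] + count_mem 1 xs.
Proof. by elim: xs => //= x xs ->; case: eqP => [->|] /=; lia. Qed.

(** A block of full height and width 1 is the same as a 1 x 2 block. *)
Lemma perm_size_full xs : 0 \notin xs -> perm_eq (map size_full xs)
  (map (pair 2) [seq x <- xs | x != 1] ++ map (pair 1) (nseq (count_mem 1 xs) 2)).
Proof.
elim: xs => //= x xs IH; rewrite inE negb_or => /andP[x0 /IH{}IH].
case: eqP => [->|x1] /=.
  by rewrite perm_sym perm_catC /= perm_cons perm_sym (permPl IH) perm_catC.
by rewrite (_ : size_full x = (2, x)) ?perm_cons // /size_full; congr pair; lia.
Qed.

(** A 2 x k block with k >= 2 always has full height, so it only narrows the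
    rectangle that is left to the 1 x k blocks. *)
Lemma mem_rect_partitions n M :
  (M \in rect_partitions 2 n) = (M \in [seq pieces_mset t | t <- pieces n]).
Proof.
apply/imfsetP/mapP => /= [[P PT ->]|[[xs zs] /piecesP[s [sn /= xP zP]] ->]].
  have [xs [us [vs [[x0 u0 v0] xu xv pe]]]] := widths_of_tiling PT.
  set c := count_mem 1 xs; set xs2 := [seq x <- xs | x != 1].
  have sx : sumn xs = sumn xs2 + c := sumn_filter1 xs.
  have zn0 : 0 \notin nseq c 2 ++ us ++ vs.
    by rewrite !mem_cat !negb_or u0 v0 !andbT; apply/negP => /nseqP[].
  exists (sort geq xs2, sort geq (nseq c 2 ++ us ++ vs)).
    apply/piecesP; exists (sumn xs2); split=> /=; first by lia.
      by apply: mem_partitions_ge2; rewrite ?mem_filter ?eqxx // (negbTE x0) andbF.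
    rewrite mem_filter; apply/andP; split.
      by apply/asboolP; exists c, us, vs; split; [rewrite perm_sort | lia | lia].
    by apply: sort_partition => //; rewrite !sumn_cat sumn_nseq; lia.
  apply/eq_seq_msetP; rewrite /block_mset; apply: perm_trans pe _ => /=.
  apply: perm_trans (perm_cat (perm_size_full x0) (perm_refl _)) _.
  rewrite -catA -!map_cat; apply: perm_cat; apply: perm_map; by rewrite perm_sym perm_sort.
move: zP; rewrite mem_filter => /andP[/asboolP[i [us [vs [zp iu iv]]]]].
rewrite mem_partitions_le => /and3P[_ z0 _].
move: xP; rewrite mem_filter mem_partitions_le => /and4P[x1 _ x0 /eqP xs_s].
have [] := @tiling_of_widths n (nseq i 1 ++ xs) us vs.
- move: z0; rewrite (perm_mem zp) !mem_cat !negb_or => /and3P[_ -> ->]; split=> //.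
  by rewrite x0 andbT; apply/negP => /nseqP[].
- by rewrite sumn_cat sumn_nseq; lia.
- by rewrite sumn_cat sumn_nseq; lia.
move=> P PT pe; exists P => //; apply/eq_seq_msetP; rewrite perm_sym.
apply: perm_trans pe _; rewrite map_cat map_nseq -catA perm_catCA /=.
have -> : map size_full xs = map (pair 2) xs.
  apply/eq_in_map => x xxs; rewrite /size_full.
  have : x != 0 by apply: contraNneq x0 => <-.
  have : x != 1 by apply: contraNneq x1 => <-.
  by move=> ? ?; congr pair; lia.
rewrite perm_cat2l perm_sym (permPl (perm_map _ zp)) !map_cat map_nseq.
by rewrite /size_full.
Qed.

Theorem rect_partition_number_conv n :
  rect_partition_number 2 n = \sum_(s < n.+1) npart_ge2 s * nsplit (n - s).
Proof.
rewrite -size_pieces -(size_map pieces_mset) /rect_partition_number.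
apply/perm_size/uniq_perm; first exact: fset_uniq.
  by rewrite map_inj_in_uniq ?uniq_pieces //; apply: pieces_mset_inj.
by move=> M; rewrite -mem_rect_partitions.
Qed.

Lemma partition_cat_ones K n r s : s \in partitions_le K n ->
  s ++ nseq r 1 \in partitions_le (n + r) (n + r).
Proof.
rewrite !mem_partitions_le => /and3P[ps s0 /eqP sn].
rewrite mem_cat negb_or s0 sumn_cat sn sumn_nseq mul1n eqxx andbT /=.
rewrite (_ : 0 \notin nseq r 1) ?andbT; last by apply/negP => /nseqP[].
have p1 x k : 0 < x -> path geq x (nseq k 1).
  by elim: k x => //= k IH x x0; rewrite /geq /= x0 IH.
case: s ps s0 sn => [|x s] /=; first by case: r => //= r _ _ <-; rewrite p1.
move=> /andP[_ ps] s0 <-; rewrite cat_path ps p1 ?andbT.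
  by rewrite /geq /= -addnA leq_addr.
by rewrite lt0n; apply: contraNneq s0 => <-; apply: mem_last.
Qed.

(** A part 1 can be added to each of the two rows. *)
Lemma nsplit_mono m : nsplit m <= nsplit m.+1.
Proof.
rewrite /nsplit -(size_map (fun s => s ++ [:: 1; 1]) (splittable_partitions m)).
apply: uniq_leq_size.
  rewrite map_inj_uniq ?filter_uniq ?uniq_partitions_le // => u v.
  by rewrite -[[:: 1; 1]]/([:: 1] ++ [:: 1]) !catA !cats1 => /rcons_inj[/rcons_inj[]].
move=> t /mapP[s + ->]; rewrite !mem_filter => /andP[/asboolP[i [us [vs [pe iu iv]]]] sp].
apply/andP; split; last first.
  by rewrite (_ : m.+1 * 2 = m * 2 + 2); [apply: (partition_cat_ones 2 sp) | lia].
apply/asboolP; exists i, (us ++ [:: 1]), (vs ++ [:: 1]); split; rewrite ?sumn_cat /=; try lia.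
by apply/permP => a; have /permP/(_ a) := pe; rewrite !count_cat /=; lia.
Qed.

Lemma nsplit_le m : nsplit m <= npart (m * 2).
Proof. by rewrite /nsplit size_filter count_size. Qed.

(** Greedy distribution: each part goes to the row that is shorter so far. *)
Lemma balanced_split r (s : seq nat) : all (fun x => x <= r) s ->
  exists us vs, perm_eq s (us ++ vs) /\ sumn us <= sumn vs <= sumn us + r.
Proof.
elim: s => [_|x s IH /= /andP[xr /IH[us [vs [pe /andP[h1 h2]]]]]].
  by exists [::], [::].
have [h|h] := leqP (x + sumn us) (sumn vs).
  by exists (x :: us), vs; rewrite /= perm_cons pe; split=> //; apply/andP; split; lia.
exists vs, (x :: us); split; last by rewrite /=; apply/andP; split; lia.
by rewrite perm_sym perm_catC /= perm_cons perm_sym.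
Qed.

(** When no part exceeds r, the greedy distribution leaves the two rows within
    r of each other, and r additional parts 1 complete both of them. *)
Lemma nsplit_ge r m : r <= m * 2 -> npart_le r (m * 2 - r) <= nsplit m.
Proof.
move=> rm; rewrite /npart_le -(size_map (fun s => s ++ nseq r 1)).
apply: uniq_leq_size.
  rewrite map_inj_uniq ?uniq_partitions_le // => u v.
  move=> uv; move/(congr1 size): (uv); rewrite !size_cat => /addIn suv.
  by move/eqP: uv; rewrite eqseq_cat // => /andP[/eqP].
move=> t /mapP[s sp ->]; rewrite mem_filter; apply/andP; split; last first.
  by have := partition_cat_ones r sp; rewrite subnK.
have := sp; rewrite mem_partitions_le => /and3P[ps _ /eqP ss].
have sr : all (fun x => x <= r) s.
  by apply: (order_path_min _ ps) => x y z; rewrite /geq /= => h1 h2; apply: leq_trans h2 h1.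
have [us [vs [pe /andP[h1 h2]]]] := balanced_split sr.
have := perm_sumn pe; rewrite sumn_cat ss => sE.
apply/asboolP; exists 0, (us ++ nseq (m - sumn us) 1), (vs ++ nseq (m - sumn vs) 1).
split; rewrite ?sumn_cat ?sumn_nseq; try lia.
apply/permP => a; have /permP/(_ a) := pe; rewrite !count_cat !count_nseq /=.
by rewrite (_ : r = (m - sumn us) + (m - sumn vs)) ?mulnDr; lia.
Qed.

(** * Leading digits *)

Section Digits.
Local Open Scope nat_scope.
Variable b : nat.
Hypothesis b1 : 1 < b.

Lemma digits_small n : n < b -> digits b n = [:: n].
Proof.
move=> nb; rewrite /digits (_ : trunc_log b n = 0); last first.
  by apply/eqP; rewrite trunc_log_eq0; lia.
by rewrite /= divn1 modn_small.
Qed.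

Lemma digits_rcons n : b <= n -> digits b n = rcons (digits b (n %/ b)) (n %% b).
Proof.
move=> bn.
have b0 : 0 < b by apply: ltnW.
have -> : digits b n = [seq n %/ b ^ i %% b | i <- rev (iota 0 (trunc_log b (n %/ b)).+2)].
  rewrite /digits; congr [seq _ | _ <- rev (iota 0 _.+1)]; apply: trunc_log_eq => //.
  have nb0 : 0 < n %/ b by rewrite divn_gt0.
  have := trunc_log_bounds b1 nb0; set L := trunc_log b _ => /andP[h1 h2].
  rewrite !expnS mulnC -leq_divRL // h1 /=.
  by rewrite mulnC -ltn_divLR // mulnC -expnS.
rewrite /digits; set L := (trunc_log b _).+1.
rewrite (_ : iota 0 L.+1 = 0 :: iota 1 L) // rev_cons map_rcons divn1; congr rcons.
rewrite (iotaDl 1 0) -map_rev -map_comp; apply: eq_map => i /=.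
by rewrite add1n expnS divnMA.
Qed.

Lemma string_value_rcons f x : string_value b (rcons f x) = string_value b f * b + x.
Proof. by rewrite /string_value foldl_rcons. Qed.

Lemma string_value_digits n : string_value b (digits b n) = n.
Proof.
elim/ltn_ind: n => n IH; have [nb|bn] := ltnP n b.
  by rewrite digits_small // /string_value /= mul0n.
rewrite digits_rcons // string_value_rcons IH -?divn_eq // ltn_Pdiv //.
by apply: leq_trans bn; apply: ltnW.
Qed.

Lemma string_value_gt0 f : digit_string b f -> 0 < string_value b f.
Proof.
elim/last_ind: f => [|f x IH]; first by rewrite /digit_string.
rewrite /digit_string all_rcons string_value_rcons => /andP[/andP[xb fb]].
case: f IH fb => [|y f] IH fb /= y0; first by rewrite mul0n add0n lt0n.
by rewrite addn_gt0 muln_gt0 IH ?/digit_string ?fb // (ltnW b1).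
Qed.

Lemma digits_string_value f : digit_string b f -> digits b (string_value b f) = f.
Proof.
elim/last_ind: f => [|f x IH]; first by rewrite /digit_string.
rewrite string_value_rcons => H; have := H; rewrite /digit_string all_rcons => /andP[/andP[xb fb]].
case: f IH fb H => [|y f] IH fb H /= y0; first by rewrite mul0n add0n digits_small.
have fs : digit_string b (y :: f) by rewrite /digit_string fb.
have v0 := string_value_gt0 fs; have b0 : 0 < b by apply: ltnW.
rewrite digits_rcons; last by apply: leq_trans (leq_addr _ _); rewrite leq_pmull.
by rewrite divnMDl // divn_small // addn0 IH // modnMDl modn_small.
Qed.

Lemma prefix_rconsE (T : eqType) (f s : seq T) x :
  prefix f (rcons s x) = prefix f s || (f == rcons s x).
Proof.
elim: s f => [|y s IH] [|z f] //=.
by rewrite IH eqseq_cons; case: (z == y).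
Qed.

Lemma prefix_seq1 (T : eqType) (f : seq T) x : f != [::] -> prefix f [:: x] = (f == [:: x]).
Proof. by case: f => [//|y [|z f] _] /=; rewrite eqseq_cons ?andbT ?andbF. Qed.

(** The nonempty prefixes of the expansion of n are the expansions of its
    positive quotients by powers of b. *)
Lemma prefix_digitsP f n : digit_string b f -> 0 < n ->
  reflect (exists k, n %/ b ^ k = string_value b f) (prefix f (digits b n)).
Proof.
move=> fs n0; have v0 := string_value_gt0 fs.
have fE m : (f == digits b m) = (string_value b f == m).
  apply/eqP/eqP => [-> |<-]; first exact: string_value_digits.
  by rewrite digits_string_value.
elim/ltn_ind: n n0 => n IH n0; have [nb|bn] := ltnP n b.
  have -> : prefix f (digits b n) = (f == digits b n).
    by rewrite digits_small // prefix_seq1 //; case: (f) fs.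
  rewrite fE; apply: (iffP eqP) => [->|[[|k] kE]]; first by exists 0; rewrite divn1.
    by rewrite -kE divn1.
  (* Since n < b, a positive quotient forces k = 0. *)
  by move: v0; rewrite -kE expnS divnMA (divn_small nb) div0n.
have b0 : 0 < b by apply: ltnW.
rewrite digits_rcons // prefix_rconsE -digits_rcons // fE.
have H := IH (n %/ b) (ltn_Pdiv b1 n0) ltac:(by rewrite divn_gt0).
apply: (iffP orP) => [[/H[k kE]|/eqP ->]|[[|k] kE]].
- by exists k.+1; rewrite expnS divnMA.
- by exists 0; rewrite divn1.
- by right; rewrite -kE divn1.
- by left; apply/H; exists k; rewrite -divnMA -expnS.
Qed.

End Digits.

Import Order.TTheory GRing.Theory Num.Theory.
Import numFieldNormedType.Exports.
Local Open Scope classical_set_scope.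
Local Open Scope ring_scope.

(** * Convolution of sequences *)

Section Convolution.
Variable R : comNzRingType.
Implicit Types s g h : nat -> R.

Definition conv s g (n : nat) : R := \sum_(k < n.+1) s k * g (n - k)%N.
Definition cumsum g (n : nat) : R := \sum_(k < n.+1) g k.

(** Truncated generating polynomials: their product computes [conv], which
    therefore inherits the ring laws. *)
Let P g N : {poly R} := \poly_(i < N.+1) g i.

Let convE s g n N : (n <= N)%N -> conv s g n = (P s N * P g N)`_n.
Proof.
move=> nN; rewrite coefM; apply: eq_bigr => i _.
have := ltn_ord i; rewrite !coef_poly => iN; do 2 rewrite (_ : (_ < N.+1)%N = true) //; lia.
Qed.

Lemma eq_conv s s' g g' n : (forall k, (k <= n)%N -> s k = s' k) ->
  (forall k, (k <= n)%N -> g k = g' k) -> conv s g n = conv s' g' n.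
Proof.
move=> ss gg; apply: eq_bigr => i _; congr (_ * _); [apply: ss | apply: gg].
  by rewrite -ltnS.
exact: leq_subr.
Qed.

Lemma convC s g n : conv s g n = conv g s n.
Proof. by rewrite !(@convE _ _ n n) // mulrC. Qed.

Lemma convA s g h n : conv s (conv g h) n = conv (conv s g) h n.
Proof.
have -> : conv s (conv g h) n = (P s n * (P g n * P h n))`_n.
  rewrite coefM; apply: eq_bigr => i _; have := ltn_ord i => iN.
  by rewrite coef_poly iN (@convE _ _ _ n) //; lia.
rewrite mulrA coefM; apply: eq_bigr => i _; have := ltn_ord i => iN.
rewrite [(P h n)`_ _]coef_poly (_ : (n - i < n.+1)%N = true); last by lia.
by rewrite (@convE _ _ _ n).
Qed.

Lemma cumsum_conv g n : cumsum g n = conv g (fun=> 1) n.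
Proof. by apply: eq_bigr => i _; rewrite mulr1. Qed.

Lemma conv_cumsum s g n : conv s (cumsum g) n = conv (cumsum s) g n.
Proof.
rewrite (@eq_conv s s (cumsum g) (conv (fun=> 1) g)) //; last first.
  by move=> k _; rewrite cumsum_conv convC.
by rewrite convA; apply: eq_conv => // k _; rewrite cumsum_conv.
Qed.

Lemma cumsumS g n : cumsum g n.+1 = cumsum g n + g n.+1.
Proof. by rewrite /cumsum big_ord_recr. Qed.

Lemma cumsum0 g : cumsum g 0 = g 0%N.
Proof. by rewrite /cumsum big_ord1. Qed.

Lemma convDr s g h n : conv s (fun k => g k + h k) n = conv s g n + conv s h n.
Proof. by rewrite /conv -big_split; apply: eq_bigr => i _; rewrite mulrDr. Qed.

(** Multiplication of the generating series by X^d. *)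
Definition shift d g (n : nat) : R := if (d <= n)%N then g (n - d)%N else 0.

Lemma conv_shift s g d n : conv s (shift d g) n = shift d (conv s g) n.
Proof.
rewrite /shift /conv; case: leqP => dn; last first.
  by rewrite big1 // => i _; rewrite (_ : (d <= n - i)%N = false) ?mulr0 //; lia.
rewrite -(big_mkord xpredT (fun k => s k * (if (d <= n - k)%N then g (n - k - d)%N else 0))).
rewrite (big_cat_nat (n := (n - d).+1)) //=; last by lia.
rewrite [X in _ + X]big_nat_cond [X in _ + X]big1 ?addr0; last first.
  by move=> i; rewrite andbT => ilt; rewrite (_ : (d <= n - i)%N = false) ?mulr0 //; lia.
rewrite big_mkord; apply: eq_bigr => i _; have := ltn_ord i => iN.
by rewrite (_ : (d <= n - i)%N = true); [congr (_ * g _); lia | lia].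
Qed.

Lemma conv_recr s g h d n : (forall k, g k = h k + shift d g k) ->
  conv s g n = conv s h n + shift d (conv s g) n.
Proof.
by move=> gE; rewrite -conv_shift -convDr; apply: eq_conv => // k _; rewrite gE.
Qed.

(** Coefficients of X F' / F for F the product of the 1 / (1 - X^d), d <= K. *)
Definition sigma_le (K k : nat) : nat := \sum_(1 <= d < K.+1 | (d %| k)%N && (0 < k)%N) d.

Lemma sigma_leS K k :
  sigma_le K.+1 k = (sigma_le K k + (if (K.+1 %| k) && (0 < k) then K.+1 else 0))%N.
Proof. by rewrite /sigma_le big_mkcond big_nat_recr //= -big_mkcond. Qed.

Let c K n : R := (npart_le K n)%:R.
Let sg K n : R := (sigma_le K n)%:R.
Let chi K k : R := if (K %| k)%N && (0 < k)%N then K%:R else 0.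

(** The identity X F' = (X F' / F) F, by induction on K: the factor
    1 / (1 - X^K) adds to X F' / F the series chi of the K X^(K j), j >= 1. *)
Lemma npart_le_conv K n : n%:R * c K n = conv (sg K) (c K) n.
Proof.
elim: K n => [|K IHK] n.
  rewrite {1}/c npart_0le /conv big1 => [|i _].
    by case: n => [|n]; rewrite ?mul0r ?mulr0.
  by rewrite /sg /sigma_le big_geq ?mul0r.
have cE k : c K.+1 k = c K k + shift K.+1 (c K.+1) k.
  by rewrite /c /shift npart_leS natrD; case: ifP.
have chiE k : chi K.+1 k = (k == K.+1)%:R * K.+1%:R + shift K.+1 (chi K.+1) k.
  rewrite /chi /shift; case: (ltngtP k K.+1) => kK.
  - by rewrite mul0r addr0; case: ifP => // /andP[/dvdn_leq]; lia.
  - have -> : (K.+1 %| k - K.+1)%N = (K.+1 %| k)%N.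
      by rewrite -[in RHS](subnK (ltnW kK)) dvdn_addl.
    by rewrite mul0r add0r subn_gt0 kK (ltn_trans _ kK).
  - by rewrite kK subnn ltnn !dvdnn /= mul1r addr0.
have sgE k : sg K.+1 k = sg K k + chi K.+1 k.
  by rewrite /sg /chi sigma_leS natrD; case: ifP.
have E m : conv (sg K.+1) (c K.+1) m = conv (sg K) (c K) m +
    shift K.+1 (conv (sg K.+1) (c K.+1)) m + shift K.+1 (fun i => K.+1%:R * c K.+1 i) m.
  have D k : conv (sg K.+1) (c K.+1) k = conv (sg K) (c K.+1) k + conv (c K.+1) (chi K.+1) k.
    by rewrite convC [in RHS]convC -convDr; apply: eq_conv => // i _; rewrite sgE.
  rewrite D (conv_recr _ _ cE) (conv_recr _ _ chiE).
  have -> : conv (c K.+1) (fun k : nat => (k == K.+1)%:R * K.+1%:R) m =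
    shift K.+1 (fun i => K.+1%:R * c K.+1 i) m.
    rewrite /conv /shift; case: (leqP K.+1 m) => mK; last first.
      by rewrite big1 // => i _; rewrite (_ : (m - i == K.+1)%N = false) ?mul0r ?mulr0 //; lia.
    have im : (m - K.+1 < m.+1)%N by lia.
    rewrite (bigD1 (Ordinal im)) //= big1 ?addr0 => [|i /eqP ij].
      by rewrite subKn // eqxx mul1r mulrC.
    rewrite (_ : (m - i == K.+1)%N = false) ?mul0r ?mulr0 //.
    by apply/eqP => e; apply: ij; apply/val_inj => /=; have := ltn_ord i; lia.
  have -> : shift K.+1 (conv (sg K.+1) (c K.+1)) m =
      shift K.+1 (conv (sg K) (c K.+1)) m + shift K.+1 (conv (c K.+1) (chi K.+1)) m.
    by rewrite /shift; case: ifP => _; rewrite ?D ?addr0.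
  ring.
elim/ltn_ind: n => n IHn; rewrite E -IHK {1}cE mulrDr -addrA; congr (_ + _).
rewrite /shift; case: (leqP K.+1 n) => Kn; last by rewrite mulr0 addr0.
by rewrite -IHn; [rewrite -mulrDl -natrD; congr (_%:R * _); lia | lia].
Qed.

End Convolution.

(** * Averages of the sum-of-divisors function *)

Definition sigma (k : nat) : nat := \sum_(1 <= d < k.+1 | (d %| k)%N) d.

Lemma sigma_leE K k : (k <= K)%N -> sigma_le K k = sigma k.
Proof.
case: k => [|k kK].
  by rewrite /sigma_le /sigma [RHS]big_geq // big1 // => i; rewrite andbF.
rewrite /sigma_le /sigma (big_cat_nat (n := k.+2)) //=.
rewrite [X in (_ + X)%N]big_nat_cond [X in (_ + X)%N]big1 ?addn0.
  by apply: eq_bigl => i; rewrite andbT.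
by move=> i /andP[ik /andP[/dvdn_leq]]; lia.
Qed.

Lemma sigma_codiv k : sigma k = (\sum_(1 <= d < k.+1 | (d %| k)%N) k %/ d)%N.
Proof.
case: k => [|k]; first by rewrite /sigma !big_geq.
rewrite /sigma -[LHS]big_filter -[RHS]big_filter.
set l := [seq d <- _ | _].
rewrite -(big_map (fun d => k.+1 %/ d)%N xpredT id); apply: perm_big.
have lP d : (d \in l) = (d %| k.+1)%N.
  rewrite mem_filter mem_index_iota ltnS; case: (boolP (_ %| _)%N) => //= dk.
  by rewrite (dvdn_leq _ dk) // andbT (dvdn_gt0 _ dk).
have ul : uniq l by rewrite filter_uniq ?iota_uniq.
apply: uniq_perm => //.
  rewrite map_inj_in_uniq // => u v; rewrite !lP => uk vk uv.
  have K d : (d %| k.+1)%N -> (k.+1 %/ (k.+1 %/ d) = d)%N by move=> dk; rewrite divnA // mulKn.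
  by rewrite -(K u) // -(K v) // uv.
move=> d; rewrite lP; apply/idP/mapP => [dk|[e]].
  exists (k.+1 %/ d)%N; last by rewrite divnA // mulKn.
  by rewrite lP dvdn_div.
by rewrite lP => ek ->; rewrite dvdn_div.
Qed.

Fixpoint tri (k : nat) : nat := if k is k'.+1 then (tri k' + k)%N else 0%N.

Lemma tri_double k : (tri k * 2 = k * k.+1)%N.
Proof. by elim: k => //= k IH; rewrite mulnDl IH; lia. Qed.

(** Both sides are the sum of d over the pairs (d, j) with d j <= x. *)
Lemma tri_sum_sigma x :
  (\sum_(k < x.+1) sigma k = \sum_(1 <= j < x.+1) tri (x %/ j))%N.
Proof.
elim: x => [|x IH]; first by rewrite big_ord1 /sigma !big_geq.
rewrite big_ord_recr /= IH sigma_codiv [in RHS]big_nat_recr //= divnn /=.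
have -> : (\sum_(1 <= j < x.+1) tri (x.+1 %/ j) = \sum_(1 <= j < x.+1) tri (x %/ j) +
   \sum_(1 <= j < x.+1 | j %| x.+1) (x.+1 %/ j))%N.
  rewrite [X in (_ + X)%N]big_mkcond -big_split /=; apply: eq_big_nat => j /andP[j0 _].
  by rewrite divnS //; case: (j %| _)%N; rewrite ?addn0.
rewrite -addnA; congr (_ + _)%N.
by rewrite big_mkcond big_nat_recr //= dvdnn divnn /= -big_mkcond.
Qed.

Section SigmaAsymptotics.
Variable R : realType.

Lemma cvg_seqP (u : nat -> R) (l : R) :
  (u @ \oo --> l) <->
  (forall e, 0 < e -> exists N, forall n, (N <= n)%N -> `|u n - l| <= e).
Proof.
split=> [/cvgrPdist_le H e e0|H].
  have [N _ HN] := H e e0; exists N => n Nn.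
  by rewrite distrC; apply: HN.
apply/cvgrPdist_le => e e0; have [N HN] := H e e0.
by exists N => // n /= Nn; rewrite distrC; apply: HN.
Qed.

(** Telescoping bound: 1 / (n + 1)^2 <= 1 / n - 1 / (n + 1). *)
Lemma inv_sq_series_cvg :
  exists2 C : R, 0 < C & [series ((k.+1%:R : R) ^- 2)]_k @ \oo --> C.
Proof.
set u := [series _]_k.
have u0 n : u n.+1 = u n + n.+1%:R ^- 2 by rewrite /u seriesSr.
have inc : nondecreasing_seq u.
  by apply/nondecreasing_seqP => n; rewrite u0 lerDl invr_ge0 exprn_ge0.
have ub n : u n.+1 <= 2 - n.+1%:R^-1.
  elim: n => [|n IH]; first by rewrite u0 /u seriesEord /= big_ord0 invr1; lra.
  rewrite u0; apply: le_trans (lerD IH (lexx _)) _.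
  have a0 : 0 < n.+1%:R :> R by [].
  rewrite -[n.+2]addn1 natrD; move: a0; set a := n.+1%:R => a0.
  rewrite -subr_ge0.
  have -> : 2 - (a + 1)^-1 - (2 - a^-1 + (a + 1) ^- 2) = a^-1 * (a + 1) ^- 2.
    by field; lra.
  by rewrite mulr_ge0 // invr_ge0 ?exprn_ge0; lra.
have cv : cvgn u.
  apply: nondecreasing_is_cvgn => //; exists 2 => _ [n _ <-].
  by apply: le_trans (inc _ _ (leqnSn n)) _; apply: le_trans (ub n) _; rewrite gerBl.
exists (limn u) => //.
apply: (@lt_le_trans _ _ (u 1%N)); last exact: nondecreasing_cvgn_le.
by rewrite u0 /u seriesEord /= big_ord0; lra.
Qed.

(** Replacing tri (x %/ j) by (x / j)^2 / 2 costs at most x / j, so the total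
    error is x times a harmonic sum, which is o(x^2) by the Cesaro theorem. *)
Lemma cumsum_sigma_asymp :
  exists2 C : R, 0 < C & (fun x => cumsum (fun k => (sigma k)%:R) x / x%:R ^+ 2) @ \oo --> C / 2.
Proof.
have [C C0 cvC] := inv_sq_series_cvg; exists C => //.
set Z := [series _]_k in cvC.
have harm0 := cesaro (@cvg_harmonic R).
rewrite -cvg_shiftS /=.
have bound x : `|cumsum (fun k => (sigma k)%:R) x.+1 / x.+1%:R ^+ 2 - Z x.+1 / 2| <=
   arithmetic_mean (@harmonic R) x.
  set X : R := x.+1%:R; have X0 : 0 < X by [].
  have SE : cumsum (fun k => (sigma k)%:R) x.+1 = \sum_(j < x.+1) (tri (x.+1 %/ j.+1))%:R :> R.
    rewrite /cumsum /= -natr_sum tri_sum_sigma big_add1 /= big_mkord.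
    by rewrite natr_sum.
  rewrite SE /Z seriesEord /= 2!mulr_suml -sumrB /arithmetic_mean seriesEord /= mulr_sumr.
  apply: le_trans (ler_norm_sum _ _ _) _; apply: ler_sum => j _.
  have := ltn_ord j; set q := (x.+1 %/ j.+1)%N => jx.
  set J : R := j.+1%:R; have J0 : 0 < J by [].
  have JX : J <= X by rewrite ler_nat.
  have tE : (tri q)%:R = q%:R * (q%:R + 1) / 2 :> R.
    have := congr1 (fun n : nat => n%:R : R) (tri_double q).
    by rewrite !natrM -[q.+1]addn1 natrD => <-; field.
  have q1 : q%:R * J <= X by rewrite -natrM ler_nat leq_divM.
  have q2 : X < (q%:R + 1) * J by rewrite natr1 -natrM ltr_nat ltn_ceil.
  have qq : 0 <= q%:R :> R by [].
  rewrite tE /harmonic -/J.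
  have -> : q%:R * (q%:R + 1) / 2 / X ^+ 2 - J ^- 2 / 2 =
    (q%:R * (q%:R + 1) * J ^+ 2 - X ^+ 2) / (2 * (X * J) ^+ 2).
    by field; lra.
  rewrite normrM normfV [ `|2 * _|]ger0_norm; last by rewrite mulr_ge0 ?sqr_ge0.
  rewrite ler_pdivrMr; last by rewrite mulr_gt0 // exprn_gt0 // mulr_gt0.
  have -> : X^-1 * J^-1 * (2 * (X * J) ^+ 2) = 2 * X * J by field; lra.
  rewrite ler_norml; apply/andP; split; nra.
apply/cvg_seqP => e e0.
have /cvg_seqP/(_ e e0)[N1 H1] := cvC.
have /cvg_seqP/(_ (e / 2))[|N2 H2] := harm0; first by rewrite divr_gt0.
exists (maxn N1 N2) => n; rewrite geq_max => /andP[n1 n2].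
have := H1 _ (leqW n1); have := H2 _ n2; have := bound n.
rewrite subr0 => /= h1 /(le_trans (ler_norm _)) h2 h3.
apply: le_trans (_ : _ <= `|Z n.+1 / 2 - C / 2| + e / 2) _.
  apply: le_trans (ler_distD (Z n.+1 / 2) _ _) _; rewrite [leRHS]addrC lerD //; exact: le_trans h1 h2.
by rewrite -mulrBl normrM [ `|2^-1|]ger0_norm //; lra.
Qed.

End SigmaAsymptotics.

(** * Growth of the partition function *)

Section Stolz.
Variable R : realType.

Lemma cvg_pinftyP (b : nat -> R) :
  (b @ \oo --> +oo) <-> (forall M, exists N, forall n, (N <= n)%N -> M <= b n).
Proof.
split=> [/cvgryPge H M|H]; first by have [N _ HN] := H M; exists N.
by apply/cvgryPge => M; have [N HN] := H M; exists N.
Qed.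

Lemma stolz_cesaro (a b : nat -> R) (l : R) :
  (forall n, b n < b n.+1) -> b @ \oo --> +oo ->
  (fun n => (a n.+1 - a n) / (b n.+1 - b n)) @ \oo --> l ->
  (fun n => a n / b n) @ \oo --> l.
Proof.
move=> incb /cvg_pinftyP binf /cvg_seqP H; apply/cvg_seqP => e e0.
have e2 : 0 < e / 2 by rewrite divr_gt0.
have [N HN] := H _ e2.
have step n : (N <= n)%N -> `|(a n - a N) - l * (b n - b N)| <= e / 2 * (b n - b N).
  elim: n => [|n IH]; first by rewrite leqn0 => /eqP ->; rewrite !subrr mulr0 subr0 normr0 mulr0.
  rewrite leq_eqVlt => /orP[/eqP <-|]; first by rewrite !subrr mulr0 subr0 normr0 mulr0.
  rewrite ltnS => Nn; have := IH Nn; have := HN n Nn.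
  have db : 0 < b n.+1 - b n by rewrite subr_gt0.
  move=> h1 h2; have {}h1 : `|a n.+1 - a n - l * (b n.+1 - b n)| <= e / 2 * (b n.+1 - b n).
    have -> : a n.+1 - a n - l * (b n.+1 - b n) =
       ((a n.+1 - a n) / (b n.+1 - b n) - l) * (b n.+1 - b n) by field; rewrite gt_eqF.
    by rewrite normrM [ `|b _ - _|]gtr0_norm // ler_pM2r.
  have -> : a n.+1 - a N - l * (b n.+1 - b N) =
    (a n - a N - l * (b n - b N)) + (a n.+1 - a n - l * (b n.+1 - b n)) by ring.
  by apply: le_trans (ler_normD _ _) _; apply: le_trans (lerD h2 h1) _; rewrite -mulrDr; lra.
pose K := `|a N - l * b N| + e / 2 * `|b N|.
have [N2 HN2] := binf (2 * K / e + 1).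
exists (maxn N N2) => n; rewrite geq_max => /andP[n1 n2].
have K0 : 0 <= K by rewrite addr_ge0 ?mulr_ge0 // ltW.
have bn : 2 * K / e + 1 <= b n by exact: HN2.
have b0 : 0 < b n by apply: lt_le_trans bn; rewrite ltr_wpDl // divr_ge0 ?mulr_ge0 // ltW.
have Kb : K <= e / 2 * b n.
  have : 2 * K / e <= b n by lra.
  by rewrite ler_pdivrMr //; lra.
have -> : a n / b n - l = (a n - l * b n) / b n by field; rewrite gt_eqF.
rewrite normrM normfV [ `|b n|]gtr0_norm // ler_pdivrMr //.
have := step n n1.
have -> : a n - l * b n = (a n - a N - l * (b n - b N)) + (a N - l * b N) by ring.
move=> h; apply: le_trans (ler_normD _ _) _; apply: le_trans (lerD h (lexx _)) _.
have : - (e / 2 * b N) <= e / 2 * `|b N|.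
  by rewrite -mulrN ler_pM2l // -normrN ler_norm.
by rewrite /K in Kb; lra.
Qed.

End Stolz.

Section PartitionGrowth.
Variable R : realType.

(** With y the partial sums of p, one has p, D and E for the first, second and
    third differences of y. *)
Let p n : R := (npart n)%:R.
Let D n : R := (npart_ge2 n)%:R.
Let y := cumsum p.
Let sg n : R := (sigma n)%:R.
Let E n : R := if n is n'.+1 then D n - D n' else D 0%N.
Let T : nat -> R := cumsum (fun k => k%:R).

Lemma npart_ge2_0 : npart_ge2 0 = 1%N. Proof. by []. Qed.
Lemma npart_ge2_1 : npart_ge2 1 = 0%N. Proof. by []. Qed.
Lemma npart0 : npart 0 = 1%N. Proof. by []. Qed.

Lemma npart_ge2_gt0 n : (1 < n)%N -> (0 < npart_ge2 n)%N.
Proof.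
elim: n => // n IH; rewrite ltnS leq_eqVlt => /orP[/eqP <- //|n1].
by apply: leq_trans (IH n1) _; apply: npart_ge2_mono; apply: ltnW.
Qed.

Lemma npart_gt0 n : (0 < npart n)%N.
Proof. exact: (@npart_mono 0 n (leq0n n)). Qed.

Lemma npart_geid n : (n <= npart n)%N.
Proof.
elim: n => // -[|n] IH //.
by rewrite npartS; have := @npart_ge2_gt0 n.+2 isT; lia.
Qed.

Lemma npartR_succ n : p n.+1 = p n + D n.+1.
Proof. by rewrite /p npartS natrD. Qed.

Lemma npartR_gt0 n : 0 < p n. Proof. by rewrite ltr0n npart_gt0. Qed.
Lemma npart_ge2R_ge0 n : 0 <= D n. Proof. by []. Qed.
Local Hint Resolve npartR_gt0 npart_ge2R_ge0 : core.

Lemma partial_sum_succ n : y n.+1 = y n + p n.+1. Proof. exact: cumsumS. Qed.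

Lemma partial_sum_diff n : y n.+1 - y n = p n.+1. Proof. by rewrite partial_sum_succ addrC addKr. Qed.
Lemma npartR_diff n : p n.+1 - p n = D n.+1. Proof. by rewrite npartR_succ addrC addKr. Qed.

Lemma cumsum_npart_ge2 n : cumsum D n = p n.
Proof. by elim: n => [|n IH]; rewrite ?cumsum0 // cumsumS IH npartR_succ. Qed.

Lemma cumsum_second_diff n : cumsum E n = D n.
Proof. by elim: n => [|n IH]; rewrite ?cumsum0 // cumsumS IH /= addrC subrK. Qed.

Lemma conv_eq_r s g g' n : g =1 g' -> conv s g n = conv s g' n :> R.
Proof. by move=> gg; apply: eq_conv. Qed.

Lemma sigma_conv_npart n : conv sg p n = n%:R * p n.
Proof.
rewrite /p npart_le_conv; apply: eq_conv => k kn; first by rewrite sigma_leE.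
by rewrite npart_leE.
Qed.

(** First difference of [sigma_conv_npart]. *)
Lemma sigma_conv_npart_ge2 n : conv sg D n.+1 = n.+1%:R * D n.+1 + p n.
Proof.
have H k : p k = D k + shift 1 p k.
  by case: k => [|k]; rewrite /shift /= ?addr0 // subn1 /= npartR_succ addrC.
have := conv_recr sg n.+1 H; rewrite /shift /= subn1 /= !sigma_conv_npart npartR_succ.
rewrite -natr1 => h; apply: (addIr (n%:R * p n)); rewrite -h; ring.
Qed.

Lemma partial_sum_conv n : y n = conv (fun k => k%:R) D n.+1.
Proof.
have idE k : k%:R = cumsum (fun k => (0 < k)%N%:R) k :> R.
  by elim: k => [|k IH]; rewrite ?cumsum0 // cumsumS -IH natr1.
rewrite (@eq_conv _ _ (cumsum (fun k => (0 < k)%N%:R)) D D) //.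
rewrite -conv_cumsum (@conv_eq_r _ _ p _ cumsum_npart_ge2) /conv big_ord_recl mul0r add0r.
rewrite /y /cumsum (reindex_inj rev_ord_inj) /=; apply: eq_bigr => i _.
by rewrite mul1r subSS.
Qed.

Lemma partial_sum_gt0 n : 0 < y n.
Proof. by elim: n => [|n IH]; rewrite ?/y ?cumsum0 ?npartR_gt0 // cumsumS addr_gt0. Qed.

Lemma triangle_ge0 n : 0 <= T n. Proof. by apply: sumr_ge0. Qed.
Local Hint Resolve partial_sum_gt0 triangle_ge0 : core.

Lemma triangle_le_partial_sum n : T n <= y n.
Proof.
by apply: ler_sum => k _; rewrite ler_nat npart_geid.
Qed.

(** Summation by parts moves the summation onto sigma, leaving the weights E
    that are nonnegative except at 1.  So the smooth approximation C T of the
    partial sums of sigma may be substituted pointwise, although sigma itself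
    is irregular. *)
Lemma recurrence_error (C e K : R) n : 0 <= e -> 0 <= K ->
  (forall k, `|cumsum sg k - C * T k| <= e * T k + K) ->
  `|n.+1%:R * D n.+1 + p n - C * y n| <= 3 * e * y n + K * (D n.+1 + 2).
Proof.
move=> e0 K0 H.
have y1 : y n = conv T E n.+1 by rewrite partial_sum_conv /T -conv_cumsum; apply: conv_eq_r => k; rewrite cumsum_second_diff.
have s1 : n.+1%:R * D n.+1 + p n = conv (cumsum sg) E n.+1.
  by rewrite -sigma_conv_npart_ge2 -conv_cumsum; apply: conv_eq_r => k; rewrite cumsum_second_diff.
have absE i : `|E i| <= E i + 2 * (i == 1%N)%:R.
  case: i => [|[|i]]; rewrite ?mulr0 ?addr0.
  - by rewrite /= ger0_norm.
  (* E 1 = D 1 - D 0 is the only negative weight. *)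
  - rewrite (_ : E 1 = -1) ?normrN1 ?eqxx; last by rewrite /E /D npart_ge2_0 npart_ge2_1 sub0r.
    by rewrite (_ : true%:R = 1 :> R) //; lra.
  - by rewrite ger0_norm // subr_ge0 ler_nat npart_ge2_mono.
have d1 : D n.+1 = conv (fun=> 1) E n.+1 by rewrite convC -cumsum_conv cumsum_second_diff.
rewrite s1 {1}y1 /conv mulr_sumr -sumrB.
apply: le_trans (ler_norm_sum _ _ _) _.
apply: (@le_trans _ _ (\sum_(k < n.+2) (e * T k + K) * (E (n.+1 - k)%N + 2 * ((n.+1 - k)%N == 1%N)%:R))).
  apply: ler_sum => k _.
  by rewrite mulrA -mulrBl normrM; apply: ler_pM => //; apply: H.
have -> : \sum_(k < n.+2) (e * T k + K) * (E (n.+1 - k)%N + 2 * ((n.+1 - k)%N == 1%N)%:R) =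
  e * conv T E n.+1 + K * conv (fun=> 1) E n.+1 + 2 * (e * T n + K).
  have -> : e * T n + K = \sum_(k < n.+2) (e * T k + K) * ((n.+1 - k)%N == 1%N)%:R.
    rewrite big_ord_recr big_ord_recr /= !subnn subSnn eqxx mulr1 mulr0 addr0 big1 ?add0r //.
    by move=> i _; rewrite (_ : (n.+1 - i == 1)%N = false) ?mulr0 //; have := ltn_ord i; lia.
  by rewrite /conv !mulr_sumr -!big_split; apply: eq_bigr => i _ /=; ring.
rewrite -y1 -d1; have : e * T n <= e * y n by rewrite ler_wpM2l // triangle_le_partial_sum.
lra.
Qed.

Lemma triangleE n : T n = n%:R * (n%:R + 1) / 2.
Proof.
rewrite /T; elim: n => [|n IH]; first by rewrite cumsum0 mul0r mul0r.
by rewrite cumsumS IH -[n.+1]addn1 natrD; field.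
Qed.

Lemma sigma_sum_approx : exists2 C : R, 0 < C & forall e, 0 < e ->
  exists2 K, 0 <= K & forall k, `|cumsum sg k - C * T k| <= e * T k + K.
Proof.
have [C C0 /cvg_seqP H] := cumsum_sigma_asymp R; exists C => // e e0.
have [N HN] := H (e / 4) ltac:(by rewrite divr_gt0).
pose M := maxn N (Num.truncn (2 * C / e)).+1.
exists (\sum_(k < M) `|cumsum sg k - C * T k|); first by apply: sumr_ge0.
move=> k; have [kM|Mk] := ltnP k M.
  rewrite (bigD1 (Ordinal kM)) //= addrCA lerDl addr_ge0 ?sumr_ge0 //.
  by rewrite mulr_ge0 // ltW.
apply: ler_wpDr; first exact: sumr_ge0.
have kN : (N <= k)%N by apply: leq_trans Mk; rewrite leq_maxl.
have k0 : 0 < k%:R :> R by rewrite ltr0n; apply: leq_trans Mk; rewrite leq_max orbT.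
have kC : 2 * C <= e * k%:R.
  rewrite [leRHS]mulrC -ler_pdivrMr //; apply/ltW/(lt_le_trans (truncnS_gt _)).
  by rewrite ler_nat; apply: leq_trans Mk; rewrite leq_maxr.
have := HN k kN; rewrite triangleE; set S := cumsum _ k; set x : R := k%:R => h.
have {}h : `|S - C / 2 * x ^+ 2| <= e / 4 * x ^+ 2.
  have -> : S - C / 2 * x ^+ 2 = (S / x ^+ 2 - C / 2) * x ^+ 2.
    by field; rewrite gt_eqF.
  by rewrite normrM [ `|x ^+ 2|]ger0_norm ?sqr_ge0 // ler_pM2r // exprn_gt0.
move: h; rewrite !ler_norml => /andP[h1 h2]; apply/andP; split; nra.
Qed.

(** As sigma k >= k, and k >= h for all but h values of k, the recurrence for p
    bounds h * y n by (n + 1 + h^2) * p (n + 1). *)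
Lemma partial_sum_small e : 0 < e -> exists N, forall n, (N <= n)%N -> y n <= e * (n.+1%:R * p n.+1).
Proof.
move=> e0.
have main h n : h%:R * y n <= (n.+1%:R + h%:R ^+ 2) * p n.+1.
  rewrite mulrDl -sigma_conv_npart /conv big_ord_recl /sg /sigma big_geq // mul0r add0r.
  rewrite /y /cumsum (reindex_inj rev_ord_inj) /= mulr_sumr.
  have cnt m : (\sum_(i < m) (i < h) <= h)%N.
    suff -> : (\sum_(i < m) (i < h))%N = minn m h by rewrite geq_minr.
    by elim: m => [|m IH]; rewrite ?big_ord0 ?min0n // big_ord_recr IH /=; lia.
  apply: (@le_trans _ _ (\sum_(i < n.+1) ((sigma i.+1)%:R * p (n - i)%N + (i < h)%N%:R * (h%:R * p n.+1)))).
    apply: ler_sum => i _; rewrite subSS.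
    have [ih|hi] := ltnP i h.
      rewrite mul1r ler_wpDl ?mulr_ge0 // ler_wpM2l // ler_nat.
      by apply: npart_mono; lia.
    rewrite mul0r addr0 ler_wpM2r // ler_nat.
    rewrite /sigma big_mkcond big_nat_recr //= dvdnn.
    by apply: leq_trans (leq_addl _ _); apply: leqW.
  rewrite big_split /= -mulr_suml; apply: lerD.
    by apply: ler_sum => i _; rewrite /bump /= add1n subSS.
  have -> : \sum_(i < n.+1) (i < h)%N%:R = (\sum_(i < n.+1) (i < h))%N%:R :> R by rewrite natr_sum.
  rewrite expr2 mulrA; apply: ler_wpM2r => //.
  by rewrite ler_wpM2r // ler_nat.
have [h [h0 hh]] : exists h : nat, 0 < h%:R :> R /\ 2 / e <= h%:R.
  exists (Num.truncn (2 / e)).+1; split=> //; exact/ltW/truncnS_gt.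
exists (h ^ 2)%N => n hn.
have := main h n; have p0 := npartR_gt0 n.+1.
have : h%:R ^+ 2 <= n.+1%:R :> R by rewrite -natrX ler_nat; apply: leqW.
have : 2 <= e * h%:R by rewrite [leRHS]mulrC -ler_pdivrMr.
set x : R := n.+1%:R; set z : R := h%:R; set q := p _; set Y := y n => a b c.
rewrite -(ler_pM2l h0) -/z; apply: le_trans c _.
have : (x + z ^+ 2) * q <= 2 * (x * q) by nra.
move=> h3; apply: le_trans h3 _; apply: (@le_trans _ _ (e * z * (x * q))).
  by rewrite ler_wpM2r // mulr_ge0 // ltW.
by rewrite [leRHS]mulrCA mulrA.
Qed.

Lemma npart_ge2_le_partial_sum : exists2 K, 0 < K & exists N, forall n, (N <= n)%N -> n.+1%:R * D n.+1 <= K * y n.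
Proof.
have [C C0 H] := sigma_sum_approx; have [K K0 HK] := H 1 ltr01.
exists (2 * (C + 3 + 2 * K)); first by lra.
exists (Num.truncn (2 * K)).+1 => n hn.
have nK : 2 * K <= n.+1%:R.
  by apply/ltW/(lt_le_trans (truncnS_gt _)); rewrite ler_nat; apply: leqW.
have := recurrence_error n ler01 K0 HK => /ler_normlW.
have y1 : 1 <= y n.
  rewrite /y /cumsum big_ord_recl /p /= -[X in X <= _]addr0 lerD // sumr_ge0 //.
have : 2 * K * D n.+1 <= n.+1%:R * D n.+1 by rewrite ler_wpM2r.
have := npartR_gt0 n; have : K * 1 <= K * y n by rewrite ler_wpM2l.
lra.
Qed.

Lemma partial_sum_pinfty : y @ \oo --> +oo.
Proof.
apply/cvg_pinftyP => M; exists (Num.truncn M).+1 => n hn.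
apply: le_trans (ltW (truncnS_gt M)) _.
apply: (@le_trans _ _ (p n)); first by rewrite ler_nat (leq_trans hn (npart_geid n)).
case: n {hn} => [|n]; first by rewrite /y cumsum0.
by rewrite partial_sum_succ lerDr ltW.
Qed.

Lemma npart_ge2_negligible : (fun n => D n.+1 / p n.+1) @ \oo --> 0.
Proof.
apply/cvg_seqP => e e0; have [K K0 [N HN]] := npart_ge2_le_partial_sum.
have [N2 HN2] := partial_sum_small (divr_gt0 e0 K0).
exists (maxn N N2) => n; rewrite geq_max => /andP[n1 n2].
rewrite subr0 ger0_norm ?divr_ge0 // ler_pdivrMr //.
have := HN n n1; have := HN2 n n2.
have n0 : 0 < n.+1%:R :> R by [].
rewrite -(ler_pM2l K0) => h1 h2; rewrite -(ler_pM2l n0).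
have -> : n.+1%:R * (e * p n.+1) = K * (e / K * (n.+1%:R * p n.+1)) by field; rewrite gt_eqF.
exact: le_trans h2 h1.
Qed.

Lemma npart_negligible : (fun n => p n / y n) @ \oo --> 0.
Proof.
apply: stolz_cesaro partial_sum_pinfty _ => [n|]; first by rewrite partial_sum_succ ltrDl.
apply: cvg_trans npart_ge2_negligible; apply: near_eq_cvg; near=> n.
by rewrite partial_sum_diff npartR_diff.
Unshelve. all: by end_near. Qed.

(** The discrete differential equation y'' = C y / n. *)
Lemma npart_ge2_asymp : exists2 C : R, 0 < C & (fun n => n.+1%:R * D n.+1 / y n) @ \oo --> C.
Proof.
have [C C0 H] := sigma_sum_approx; exists C => //; apply/cvg_seqP => e e0.
have e6 : 0 < e / 6 by rewrite divr_gt0.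
have [K K0 HK] := H _ e6.
have [K' K'0 [N HN]] := npart_ge2_le_partial_sum.
have /cvg_seqP/(_ (e / 6) e6)[N1 HN1] := npart_negligible.
have /cvg_pinftyP/(_ (K * (K' + 2) * 6 / e))[N2 HN2] := partial_sum_pinfty.
pose N3 := (Num.truncn (K * K' * 6 / e)).+1.
exists (maxn (maxn N N1) (maxn N2 N3)) => n; rewrite !geq_max => /andP[/andP[n1 n2] /andP[n3 n4]].
have y0 := partial_sum_gt0 n.
have -> : n.+1%:R * D n.+1 / y n - C = (n.+1%:R * D n.+1 + p n - C * y n - p n) / y n.
  by field; rewrite gt_eqF.
rewrite normrM normfV [ `|y n|]gtr0_norm // ler_pdivrMr //.
apply: le_trans (ler_normB _ _) _.
apply: le_trans (lerD (recurrence_error n (ltW e6) K0 HK) (lexx _)) _.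
have := HN1 n n2; rewrite subr0 normrM normfV [ `|y n|]gtr0_norm // ler_pdivrMr // => hp.
have hK : K * (K' + 2) * 6 <= e * y n by rewrite [leRHS]mulrC -ler_pdivrMr // HN2.
have n0 : 1 <= n.+1%:R :> R by rewrite ler1n.
have hK2 : K * K' * 6 <= e * n.+1%:R.
  rewrite [leRHS]mulrC -ler_pdivrMr //; apply/ltW/(lt_le_trans (truncnS_gt _)).
  by rewrite ler_nat; apply: leqW.
have KD : K * D n.+1 <= e / 6 * y n.
  rewrite -(@ler_pM2l _ n.+1%:R) //.
  have h := ler_wpM2l K0 (HN n n1).
  have h2 := ler_wpM2r (ltW y0) hK2.
  lra.
have KK' : 0 <= K * K' by rewrite mulr_ge0 // ltW.
lra.
Qed.

(** Conservation of energy for y'' = C y / n: the increments of n y'^2 and of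
    C y^2 are both equivalent to 2 C y y', so Stolz-Cesaro applies. *)
Lemma npart_sq_asymp (C : R) : (fun n => n.+1%:R * D n.+1 / y n) @ \oo --> C ->
  (fun n => n%:R * p n ^+ 2 / y n ^+ 2) @ \oo --> C.
Proof.
move=> eC; apply: stolz_cesaro => [n||].
- by rewrite partial_sum_succ ltr_pXn2r ?nnegrE ?addr_ge0 ?ltW // ltrDl.
- apply/cvg_pinftyP => M; have /cvg_pinftyP/(_ (Num.max 1 M))[N HN] := partial_sum_pinfty.
  exists N => n /HN; rewrite ge_max => /andP[y1 yM]; apply: le_trans yM _.
  by rewrite expr2 ler_peMl // ltW.
pose q n := p n.+1 / y n.+1; pose r n := D n.+1 / p n.+1; pose e n := n.+1%:R * D n.+1 / y n.
have q0 : q @ \oo --> 0 by move: npart_negligible; rewrite -cvg_shiftS.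
(* Numerator and denominator are divided by p n.+1 * y n.+1. *)
have -> : (fun n => (n.+1%:R * p n.+1 ^+ 2 - n%:R * p n ^+ 2) / (y n.+1 ^+ 2 - y n ^+ 2)) =
  (fun n => ((1 - r n) ^+ 2 * q n + e n * (1 - q n) * (2 - r n)) / (2 - q n)).
  apply/funext => n; rewrite /q /r /e.
  have p0 := npartR_gt0 n; have p0' := npartR_gt0 n.+1; have y0 := partial_sum_gt0 n; have y0' := partial_sum_gt0 n.+1.
  have -> : D n.+1 = p n.+1 - p n by rewrite npartR_diff.
  have -> : y n = y n.+1 - p n.+1 by rewrite partial_sum_succ addrK.
  have y3 : 0 < y n.+1 - p n.+1 by rewrite partial_sum_succ addrK.
  rewrite -[n.+1%:R]natr1; field.
  rewrite -/(p n.+1); set P := p n.+1; set Y := y n.+1.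
  have h1 : 0 < 2 * Y - P by rewrite /Y /P; lra.
  have h2 : 0 < Y ^+ 2 - (Y - P) ^+ 2.
    by rewrite (_ : _ - _ = P * (2 * Y - P)) ?mulr_gt0 //; ring.
  by rewrite !gt_eqF.
have -> : C = ((1 - 0) ^+ 2 * 0 + C * (1 - 0) * (2 - 0)) / (2 - 0) by field.
have c1 : (fun n => 1 - r n) @ \oo --> (1 - 0 : R) by apply: cvgB npart_ge2_negligible; apply: cvg_cst.
have c2 : (fun n => 2 - r n) @ \oo --> (2 - 0 : R) by apply: cvgB npart_ge2_negligible; apply: cvg_cst.
have c3 : (fun n => 1 - q n) @ \oo --> (1 - 0 : R) by apply: cvgB q0; apply: cvg_cst.
have c4 : (fun n => 2 - q n) @ \oo --> (2 - 0 : R) by apply: cvgB q0; apply: cvg_cst.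
apply: cvgM; last by apply: (cvgV _ c4); rewrite subr0.
apply: cvgD; last by apply: cvgM c2; apply: cvgM c3.
apply: cvgM q0; exact: (cvgM c1 c1).
Qed.

Lemma npart_ratio : exists2 lam : R, 0 < lam &
  (fun n => Num.sqrt n.+1%:R * ((npart_ge2 n.+1)%:R / (npart n.+1)%:R)) @ \oo --> lam.
Proof.
have [C C0 eC] := npart_ge2_asymp; exists (Num.sqrt C); first by rewrite sqrtr_gt0.
have ec : (fun n => n.+1%:R * p n.+1 ^+ 2 / y n.+1 ^+ 2) @ \oo --> C.
  by have := npart_sq_asymp eC; rewrite -cvg_shiftS.
have -> : (fun n => Num.sqrt n.+1%:R * ((npart_ge2 n.+1)%:R / (npart n.+1)%:R)) =
   (fun n => Num.sqrt ((n.+1%:R * D n.+1 / y n * (1 - p n.+1 / y n.+1)) ^+ 2 /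
       (n.+1%:R * p n.+1 ^+ 2 / y n.+1 ^+ 2))).
  apply/funext => n; have p0 := npartR_gt0 n.+1; have y0 := partial_sum_gt0 n; have y0' := partial_sum_gt0 n.+1.
  have -> : (n.+1%:R * D n.+1 / y n * (1 - p n.+1 / y n.+1)) ^+ 2 / (n.+1%:R * p n.+1 ^+ 2 / y n.+1 ^+ 2)
      = n.+1%:R * (D n.+1 / p n.+1) ^+ 2.
    have -> : 1 - p n.+1 / y n.+1 = y n / y n.+1 by rewrite partial_sum_succ; field; rewrite -partial_sum_succ gt_eqF.
    by field; rewrite nat1r !gt_eqF.
  by rewrite sqrtrM // sqrtr_sqr ger0_norm // divr_ge0.
have q0 : (fun n => p n.+1 / y n.+1) @ \oo --> 0 by move: npart_negligible; rewrite -cvg_shiftS.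
have c3 : (fun n => 1 - p n.+1 / y n.+1) @ \oo --> (1 - 0 : R) by apply: cvgB q0; apply: cvg_cst.
have c4 : (fun n => n.+1%:R * D n.+1 / y n * (1 - p n.+1 / y n.+1)) @ \oo --> C * (1 - 0).
  exact: cvgM eC c3.
have c5 : (fun n => (n.+1%:R * D n.+1 / y n * (1 - p n.+1 / y n.+1)) ^+ 2 /
    (n.+1%:R * p n.+1 ^+ 2 / y n.+1 ^+ 2)) @ \oo --> (C * (1 - 0)) * (C * (1 - 0)) / C.
  exact: (cvgM (cvgM c4 c4) (cvgV (lt0r_neq0 C0) ec)).
have -> : Num.sqrt C = Num.sqrt ((C * (1 - 0)) * (C * (1 - 0)) / C).
  by congr Num.sqrt; field; rewrite gt_eqF.
exact: (@continuous_cvg _ _ _ _ _ _ (@Num.sqrt R) _ (@sqrt_continuous R _) c5).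
Qed.

End PartitionGrowth.

(** * Logarithmic growth *)

Section LogIncrements.
Variable R : realType.
Implicit Types (a f : nat -> R) (kap : R).

Lemma sqrt_inv_cvg0 : (fun n => (Num.sqrt n.+1%:R)^-1 : R) @ \oo --> (0 : R).
Proof.
have -> : (fun n => (Num.sqrt n.+1%:R)^-1 : R) = @Num.sqrt R \o (@harmonic R).
  by apply/funext => n /=; rewrite sqrtrV.
rewrite -[X in _ --> X]sqrtr0.
exact: (@continuous_cvg _ _ _ _ _ _ (@Num.sqrt R) _ (@sqrt_continuous R _) (@cvg_harmonic R)).
Qed.

Lemma sqrt_succ_gt0 n : 0 < Num.sqrt n.+1%:R :> R.
Proof. by rewrite sqrtr_gt0. Qed.
Local Hint Resolve sqrt_succ_gt0 : core.

Lemma cvg0_of_sqrt_mul (x : nat -> R) kap :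
  (fun n => Num.sqrt n.+1%:R * x n) @ \oo --> kap -> x @ \oo --> (0 : R).
Proof.
move=> xk; have -> : x = (fun n => (Num.sqrt n.+1%:R * x n) * (Num.sqrt n.+1%:R)^-1).
  by apply/funext => n; rewrite mulrAC divff ?mul1r // gt_eqF.
have -> : 0 = kap * 0 by rewrite mulr0.
exact: cvgM xk sqrt_inv_cvg0.
Qed.

(** Squeeze by x <= - ln (1 - x) <= x / (1 - x). *)
Lemma ln_increment_cvg a kap : (forall n, 0 < a n) ->
  (fun n => Num.sqrt n.+1%:R * (1 - a n / a n.+1)) @ \oo --> kap ->
  (fun n => Num.sqrt n.+1%:R * (ln (a n.+1) - ln (a n))) @ \oo --> kap.
Proof.
move=> a0 ak; pose x n := 1 - a n / a n.+1.
have x1 n : 0 < 1 - x n by rewrite /x subKr divr_gt0.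
have x0 : x @ \oo --> (0 : R) := cvg0_of_sqrt_mul ak.
have up : (fun n => Num.sqrt n.+1%:R * x n * (1 - x n)^-1) @ \oo --> kap.
  have -> : kap = kap * (1 - 0)^-1 by rewrite subr0 invr1 mulr1.
  have c1 : (fun n => 1 - x n) @ \oo --> (1 - 0 : R) by apply: cvgB x0; apply: cvg_cst.
  by apply: cvgM ak _; apply: (cvgV _ c1); rewrite subr0.
have lnE n : ln (a n.+1) - ln (a n) = - ln (1 - x n).
  by rewrite /x subKr ln_div ?posrE // opprB.
apply: (squeeze_cvgr _ ak up); apply: nearW => n.
rewrite lnE -/(x n) -mulrA !ler_pM2l //; apply/andP; split.
  rewrite lerNr; apply: le_ln1Dx; by have := x1 n; lra.
rewrite -lnV ?posrE //; set z := _^-1.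
have zE : z = 1 + x n * z by rewrite /z; field; rewrite gt_eqF.
have z0 : 0 < z by rewrite invr_gt0.
by rewrite {1}zE; apply: le_ln1Dx; lra.
Qed.

Lemma sqrt_ratio_cvg1 : (fun n => Num.sqrt n%:R / Num.sqrt n.+1%:R) @ \oo --> (1 : R).
Proof.
have -> : (fun n => Num.sqrt n%:R / Num.sqrt n.+1%:R) = @Num.sqrt R \o (fun n => 1 - harmonic n).
  apply/funext => n /=; rewrite -sqrtrV // -sqrtrM // /harmonic; congr Num.sqrt.
  by rewrite -[n.+1%:R]natr1; field; rewrite natr1 pnatr_eq0.
rewrite -[X in _ --> X]sqrtr1 -[X in _ --> Num.sqrt X]subr0.
apply: (@continuous_cvg _ _ _ _ _ _ (@Num.sqrt R) _ (@sqrt_continuous R _)).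
by apply: cvgB (@cvg_harmonic R); apply: cvg_cst.
Qed.

(** Stolz-Cesaro against sqrt n, whose increments are equivalent to
    1 / (2 sqrt n). *)
Lemma cvg_div_sqrt f kap :
  (fun n => Num.sqrt n.+1%:R * (f n.+1 - f n)) @ \oo --> kap ->
  (fun n => f n / Num.sqrt n%:R) @ \oo --> 2 * kap.
Proof.
move=> fk; apply: stolz_cesaro => [n||].
- by rewrite ltr_sqrt // ltr_nat.
- apply/cvg_pinftyP => M; exists (Num.truncn (M ^+ 2)).+1 => n hn.
  rewrite (le_trans (ler_norm M)) // -sqrtr_sqr ler_sqrt //.
  by apply/ltW/(lt_le_trans (truncnS_gt _)); rewrite ler_nat.
have -> : (fun n => (f n.+1 - f n) / (Num.sqrt n.+1%:R - Num.sqrt n%:R)) =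
  (fun n => Num.sqrt n.+1%:R * (f n.+1 - f n) * (1 + Num.sqrt n%:R / Num.sqrt n.+1%:R)).
  apply/funext => n; have h : Num.sqrt n%:R < Num.sqrt n.+1%:R :> R by rewrite ltr_sqrt // ltr_nat.
  have e : Num.sqrt n.+1%:R ^+ 2 = Num.sqrt n%:R ^+ 2 + 1 :> R by rewrite !sqr_sqrtr // natr1.
  move: h e (sqrt_succ_gt0 n); set s := Num.sqrt n.+1%:R; set t := Num.sqrt _ => h e s0.
  have -> : (s - t)^-1 = s + t.
    by apply: (mulIf (_ : s - t != 0)); rewrite ?mulVf ?subr_eq0 ?gt_eqF // mulrC -subr_sqr e; ring.
  by field; rewrite gt_eqF.
have -> : 2 * kap = kap * (1 + 1) by ring.
by apply: cvgM fk _; apply: cvgD sqrt_ratio_cvg1; apply: cvg_cst.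
Qed.

End LogIncrements.

Lemma ln_npart_asymp (R : realType) : exists2 lam : R, 0 < lam &
  (fun n => Num.sqrt n.+1%:R * (1 - (npart n)%:R / (npart n.+1)%:R)) @ \oo --> lam /\
  (fun n => ln (npart n)%:R / Num.sqrt n%:R) @ \oo --> 2 * lam.
Proof.
have [lam l0 H] := npart_ratio R; exists lam => //.
have H1 : (fun n => Num.sqrt n.+1%:R * (1 - (npart n)%:R / (npart n.+1)%:R)) @ \oo --> lam.
  apply: cvg_trans H; apply: near_eq_cvg; apply: nearW => n; congr (_ * _).
  have : 0 < (npart n.+1)%:R :> R by rewrite ltr0n npart_gt0.
  by rewrite npartS natrD => h; field; rewrite gt_eqF.
split=> //; apply: cvg_div_sqrt; apply: (@ln_increment_cvg R (fun n => (npart n)%:R)) H1 => n.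
by rewrite ltr0n npart_gt0.
Qed.

(** * Concentration of the convolution *)

Section Concentration.
Variable R : realType.

Let p n : R := (npart n)%:R.
Let D n : R := (npart_ge2 n)%:R.
Let Q n : R := (nsplit n)%:R.
Let w n : R := if n is m.+1 then Q n - Q m else Q 0%N.
Let A n : R := (rect_partition_number 2 n)%:R.

Lemma splitting_increment_bounds n : 0 <= w n <= p (n * 2).
Proof.
have Qp m : Q m <= p (m * 2) by rewrite ler_nat nsplit_le.
case: n => [|n]; first by rewrite Qp /= ler0n.
by rewrite /w subr_ge0 ler_nat nsplit_mono /= (le_trans _ (Qp _)) // gerBl.
Qed.

Lemma cumsum_split_diff n : cumsum w n = Q n.
Proof. by elim: n => [|n IH]; rewrite ?cumsum0 // cumsumS IH /= addrC subrK. Qed.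

Lemma rect_conv n : A n = conv D Q n.
Proof.
rewrite /A rect_partition_number_conv natr_sum.
by apply: eq_bigr => i _; rewrite natrM.
Qed.

(** Summation by parts.  In this form the increments of A only involve those
    of p, against the nonnegative weights w. *)
Lemma rect_conv_npart n : A n = conv p w n.
Proof.
rewrite rect_conv -(@eq_conv R D D (cumsum w)) // => [|k _]; last exact: cumsum_split_diff.
by rewrite conv_cumsum; apply: eq_conv => // k _; exact: cumsum_npart_ge2.
Qed.

Lemma rect_increment n : A n.+1 - A n = conv D w n.+1.
Proof.
have H k : p k = D k + shift 1 p k.
  by case: k => [|k]; rewrite /shift /= ?addr0 // subn1 /= addrC /p /D -natrD npartS.
rewrite !rect_conv_npart ![conv _ w _]convC (conv_recr w n.+1 H) /shift /= subn1 /=.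
by rewrite addrK convC.
Qed.

Lemma rect_increment_ge0 n : 0 <= A n.+1 - A n.
Proof.
rewrite rect_increment; apply: sumr_ge0 => i _.
by rewrite mulr_ge0 //; have /andP[] := splitting_increment_bounds (n.+1 - i).
Qed.

(** A is nondecreasing, and its partial sums are the convolution of p and Q. *)
Lemma rect_ge_term n j : (j <= n)%N -> p j * Q (n - j) <= n.+1%:R * A n.
Proof.
move=> jn.
have -> : n.+1%:R * A n = \sum_(i < n.+1) A n by rewrite sumr_const card_ord mulr_natl.
have mono m k : (m <= k)%N -> A m <= A k.
  elim: k => [|k IH]; first by rewrite leqn0 => /eqP ->.
  rewrite leq_eqVlt => /orP[/eqP -> //|/IH h]; apply: le_trans h _.
  by rewrite -subr_ge0 rect_increment_ge0.
apply: (@le_trans _ _ (cumsum A n)); last first.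
  by apply: ler_sum => i _; apply: mono; rewrite -ltnS.
have -> : cumsum A n = conv p Q n.
  rewrite cumsum_conv -(@eq_conv R (conv D Q) A (fun=> 1) (fun=> 1)) // => [|k _]; last by rewrite rect_conv.
  rewrite -convA -(@eq_conv R D D (cumsum Q)) // => [|k _]; last by rewrite cumsum_conv.
  by rewrite conv_cumsum; apply: eq_conv => // k _; exact: cumsum_npart_ge2.
have jn' : (j < n.+1)%N by [].
rewrite /conv (bigD1 (Ordinal jn')) //= lerDl; apply: sumr_ge0 => i _.
by rewrite mulr_ge0.
Qed.

Lemma ln_succ_small : (fun n => ln n.+1%:R / Num.sqrt n%:R) @ \oo --> (0 : R).
Proof.
rewrite -[X in _ --> X](mulr0 2); apply: cvg_div_sqrt.
apply: (@ln_increment_cvg R (fun n => n.+1%:R)) => //.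
have c0 : (fun=> 0 : R) @ \oo --> (0 : R) by exact: cvg_cst.
apply: (squeeze_cvgr _ c0 (@sqrt_inv_cvg0 R)); apply: nearW => n.
have s0 := sqrt_succ_gt0 R n.
have e : Num.sqrt n.+1%:R ^+ 2 = n.+1%:R :> R by rewrite sqr_sqrtr.
have -> : 1 - n.+1%:R / n.+2%:R = n.+2%:R^-1 :> R.
  have : 0 < n.+1%:R :> R by [].
  by rewrite -[n.+2]addn1 natrD; set x : R := n.+1%:R => x0; field; lra.
apply/andP; split; first by rewrite mulr_ge0 // ltW.
rewrite -(ler_pM2l s0) mulrA -expr2 e divff ?gt_eqF // ler_pdivrMr // mul1r.
by rewrite ler_nat.
Qed.

Variable lam : R.
Hypothesis lam_gt0 : 0 < lam.
Hypothesis npart_ratio_lam :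
  (fun n => Num.sqrt n.+1%:R * (1 - (npart n)%:R / (npart n.+1)%:R)) @ \oo --> lam.
Hypothesis ln_npart_lam : (fun n => ln (npart n)%:R / Num.sqrt n%:R) @ \oo --> 2 * lam.

Lemma ln_npart_subseq (k : nat -> nat) (x : R) : 0 < x ->
  (fun n => (k n)%:R / n%:R) @ \oo --> x ->
  (fun n => ln (p (k n)) / Num.sqrt n%:R) @ \oo --> 2 * lam * Num.sqrt x.
Proof.
move=> x0 kx.
have kinf : k @ \oo --> \oo.
  apply/cvgnyPge => M; have /cvg_seqP/(_ (x / 2))[|N HN] := kx; first by rewrite divr_gt0.
  exists (maxn (maxn N 1) (Num.truncn (M%:R * 2 / x)).+1) => // n /=.
  rewrite !geq_max => /andP[/andP[n1 n2] n3].
  have n0 : 0 < n%:R :> R by rewrite ltr0n.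
  have := HN n n1; rewrite ler_norml => /andP[+ _] => h.
  have {}h : x / 2 * n%:R <= (k n)%:R by rewrite -ler_pdivlMr //; lra.
  rewrite -(ler_nat R); apply: le_trans h.
  have : M%:R * 2 / x <= n%:R.
    by apply/ltW/(lt_le_trans (truncnS_gt _)); rewrite ler_nat.
  by rewrite ler_pdivrMr //; lra.
have -> : (fun n => ln (p (k n)) / Num.sqrt n%:R) =
  (fun n => (ln (p (k n)) / Num.sqrt (k n)%:R) * Num.sqrt ((k n)%:R / n%:R)).
  apply/funext => n; rewrite sqrtrM // sqrtrV //.
  have [->|k0] := posnP (k n); first by rewrite /p npart0 ln1 !mul0r.
  by rewrite mulrA divfK // gt_eqF // sqrtr_gt0 ltr0n.
apply: cvgM; first exact: (cvg_comp _ _ kinf ln_npart_lam).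
exact: (@continuous_cvg _ _ _ _ _ _ (@Num.sqrt R) _ (@sqrt_continuous R _) kx).
Qed.

Lemma divn_ratio_cvg t : (0 < t)%N ->
  (fun n => (n %/ t)%:R / n%:R) @ \oo --> (t%:R^-1 : R).
Proof.
move=> t0; have t0' : 0 < t%:R :> R by rewrite ltr0n.
apply/cvg_seqP => e e0; exists (Num.truncn (e^-1)).+1 => n hn.
have n0 : 0 < n%:R :> R by rewrite ltr0n; apply: leq_trans hn.
have en : 1 <= e * n%:R.
  rewrite -ler_pdivrMl // mulr1; apply/ltW/(lt_le_trans (truncnS_gt _)); by rewrite ler_nat.
have h1 : (n %/ t)%:R * t%:R <= n%:R :> R by rewrite -natrM ler_nat leq_divM.
have h2 : n%:R < ((n %/ t)%:R + 1) * t%:R :> R by rewrite natr1 -natrM ltr_nat ltn_ceil.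
move: h1 h2; set q : R := (n %/ t)%:R => h1 h2.
have -> : q / n%:R - t%:R^-1 = (q * t%:R - n%:R) / (n%:R * t%:R) by field; rewrite !gt_eqF.
rewrite normrM normfV [ `|n%:R * _|]gtr0_norm ?mulr_gt0 // ler_pdivrMr ?mulr_gt0 //.
rewrite ler_norml; apply/andP; split; nra.
Qed.

Lemma leq_divn_double t n : (2 <= t)%N -> (n %/ t <= (n - n %/ 3) * 2 - n %/ t)%N.
Proof.
move=> t2; have h1 : (n %/ t <= n %/ 2)%N by apply: leq_div2l.
by lia.
Qed.

Lemma index_ratio_cvg t : (2 <= t)%N ->
  (fun n => ((n - n %/ 3) * 2 - n %/ t)%N%:R / n%:R) @ \oo --> (2 * (1 - 3%:R^-1) - t%:R^-1 : R).
Proof.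
move=> t2; have c3 := @divn_ratio_cvg 3 isT; have ct := divn_ratio_cvg (ltnW t2).
have aE n : ((n - n %/ 3) * 2 - n %/ t)%N%:R / n%:R =
    2 * ((n%:R / n%:R) - (n %/ 3)%:R / n%:R) - (n %/ t)%:R / n%:R :> R.
  rewrite natrB; last by apply: leq_trans (leq_subr _ _); exact: leq_divn_double t2.
  by rewrite natrM natrB ?leq_div //; ring.
have one : (fun n => n%:R / n%:R) @ \oo --> (1 : R).
  apply/cvg_seqP => e e0; exists 1%N => n n1.
  by rewrite divff ?subrr ?normr0 ?ltW // pnatr_eq0 -lt0n.
under eq_fun do rewrite aE.
by apply: cvgB ct; apply: cvgM; [exact: cvg_cst | apply: cvgB one c3].
Qed.

(** In the bound of [nsplit_ge] with r = n %/ t, the partitions having a part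
    above r number at most 2 (n + 1) times p at an argument smaller by r, which is
    exponentially small in comparison since r is proportional to n. *)
Lemma nsplit_half_npart t : (2 <= t)%N -> exists N, forall n, (N <= n)%N ->
  p ((n - n %/ 3) * 2 - n %/ t) <= 2 * Q (n - n %/ 3).
Proof.
move=> t2; have t0 : (0 < t)%N by apply: ltnW.
have tR : 2 <= t%:R :> R by rewrite ler_nat.
pose m n := ((n - n %/ 3) * 2)%N; pose a n := (m n - n %/ t)%N; pose b n := (a n - n %/ t)%N.
have an n : (n %/ t <= a n)%N := leq_divn_double n t2.
have tV : 0 < t%:R^-1 :> R by rewrite invr_gt0; lra.
have tV2 : t%:R^-1 <= 2^-1 :> R by rewrite lef_pV2 // posrE; lra.
have ct := divn_ratio_cvg t0; have ca := index_ratio_cvg t2.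
have cb : (fun n => (b n)%:R / n%:R) @ \oo --> (2 * (1 - 3%:R^-1) - t%:R^-1 - t%:R^-1 : R).
  have bE n : (b n)%:R / n%:R = (a n)%:R / n%:R - (n %/ t)%:R / n%:R :> R.
    by rewrite /b natrB // mulrBl.
  under eq_fun do rewrite bE.
  exact: cvgB ca ct.
set xa := 2 * (1 - 3%:R^-1) - t%:R^-1 in ca cb.
have xb0 : 0 < xa - t%:R^-1 by rewrite /xa; lra.
have xa0 : 0 < xa by lra.
have la := ln_npart_subseq xa0 ca; have lb := ln_npart_subseq xb0 cb.
have ls := ln_succ_small.
have s4' : (fun n => ln 4 / Num.sqrt n.+1%:R) @ \oo --> (ln 4 * 0 : R).
  by apply: cvgM (@sqrt_inv_cvg0 R); apply: cvg_cst.
have s4 : (fun n => ln 4 / Num.sqrt n%:R) @ \oo --> (0 : R).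
  by rewrite mulr0 in s4'; rewrite -cvg_shiftS.
have lim : (fun n => ln (p (a n)) / Num.sqrt n%:R - ln (p (b n)) / Num.sqrt n%:R -
    ln n.+1%:R / Num.sqrt n%:R - ln 4 / Num.sqrt n%:R) @ \oo -->
    2 * lam * Num.sqrt xa - 2 * lam * Num.sqrt (xa - t%:R^-1) - 0 - 0.
  by apply: cvgB s4; apply: cvgB ls; apply: cvgB la lb.
rewrite !subr0 -mulrBr in lim.
have pos : 0 < 2 * lam * (Num.sqrt xa - Num.sqrt (xa - t%:R^-1)).
  by rewrite !mulr_gt0 // subr_gt0 ltr_sqrt //; lra.
have /cvg_seqP/(_ _ pos)[N HN] := lim.
exists (maxn N 1) => n; rewrite geq_max => /andP[n1 n2].
have s0 : 0 < Num.sqrt n%:R :> R by rewrite sqrtr_gt0 ltr0n.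
have := HN n n1; rewrite ler_norml => /andP[+ _] => h.
have {}h : 0 <= ln (p (a n)) - ln (p (b n)) - ln n.+1%:R - ln 4.
  by rewrite -(pmulr_lge0 _ (_ : 0 < (Num.sqrt n%:R)^-1)) ?invr_gt0 // !mulrBl; lra.
have p0 k : 0 < p k by rewrite ltr0n npart_gt0.
have {}h : 4 * n.+1%:R * p (b n) <= p (a n).
  by rewrite -ler_ln ?posrE ?mulr_gt0 // lnM ?posrE ?mulr_gt0 // lnM ?posrE //; lra.
have r2m : (n %/ t <= m n)%N by apply: leq_trans (an n) (leq_subr _ _).
have q1 := nsplit_ge r2m; have q2 := npart_le_ge (n %/ t) (a n).
have q3 : p (a n) <= Q (n - n %/ 3) + (a n)%:R * p (b n).
  rewrite -natrM -natrD ler_nat; apply: leq_trans q2 _.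
  by rewrite leq_add2r.
have q4 : (a n)%:R * p (b n) <= 2 * n.+1%:R * p (b n).
  rewrite ler_pM2r // -natrM ler_nat; apply: leq_trans (leq_subr _ _) _.
  by rewrite /m; clear; lia.
rewrite -/(m n) -/(a n); lra.
Qed.

Lemma rect_gt0 n : 0 < A n.
Proof.
rewrite rect_conv_npart; apply: lt_le_trans (_ : w 0 <= _).
  by rewrite /w /Q ltr0n; apply: leq_trans (@nsplit_ge 0 0 isT).
have h0 : (n < n.+1)%N by [].
rewrite /conv (bigD1 (Ordinal h0)) //= subnn -[X in X <= _]mul1r -[X in X <= _]addr0.
apply: lerD; last first.
  by apply: sumr_ge0 => i _; rewrite mulr_ge0 //; have /andP[] := splitting_increment_bounds (n - i).
by rewrite ler_wpM2r // ?ler0n // ler1n npart_gt0.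
Qed.

(** The term j = n %/ 3 of the convolution is enough, because
    sqrt (1/3) + sqrt (4/3) = sqrt 3; the loss due to t vanishes as t grows. *)
Lemma ln_rect_lower_bound e : 0 < e -> exists N, forall n, (N <= n)%N ->
  (2 * lam * Num.sqrt 3 - e) * Num.sqrt n%:R <= ln (A n).
Proof.
move=> e0.
(* The loss due to t is at most 2 lam / t <= e / 2. *)
pose t := (Num.truncn (4 * lam / e)).+2.
have t2 : (2 <= t)%N by [].
have tR : 2 <= t%:R :> R by rewrite ler_nat.
have te : 4 * lam <= e * t%:R.
  rewrite -ler_pdivrMl // mulrC; apply/ltW/(lt_le_trans (truncnS_gt _)); by rewrite ler_nat.
have [N1 H1] := nsplit_half_npart t2.
have tV : 0 < t%:R^-1 :> R by rewrite invr_gt0; lra.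
have tV2 : t%:R^-1 <= 2^-1 :> R by rewrite lef_pV2 // posrE; lra.
have xa0 : 0 < 2 * (1 - 3%:R^-1) - t%:R^-1 :> R by lra.
have third0 : 0 < 3%:R^-1 :> R by [].
have la := ln_npart_subseq xa0 (index_ratio_cvg t2).
have lj := ln_npart_subseq third0 (@divn_ratio_cvg 3 isT).
have s2' : (fun n => ln 2 / Num.sqrt n.+1%:R) @ \oo --> (ln 2 * 0 : R).
  by apply: cvgM (@sqrt_inv_cvg0 R); apply: cvg_cst.
have s2 : (fun n => ln 2 / Num.sqrt n%:R) @ \oo --> (0 : R).
  by rewrite mulr0 in s2'; rewrite -cvg_shiftS.
pose l := 2 * lam * Num.sqrt 3%:R^-1 + 2 * lam * Num.sqrt (2 * (1 - 3%:R^-1) - t%:R^-1) - 0 - 0.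
have lim : (fun n => ln (p (n %/ 3)) / Num.sqrt n%:R +
    ln (p ((n - n %/ 3) * 2 - n %/ t)) / Num.sqrt n%:R -
    ln n.+1%:R / Num.sqrt n%:R - ln 2 / Num.sqrt n%:R) @ \oo --> l.
  by apply: cvgB s2; apply: cvgB ln_succ_small; apply: cvgD lj la.
have lE : 2 * lam * Num.sqrt 3 - e / 2 <= l.
  have r3 : 0 < Num.sqrt 3 :> R by rewrite sqrtr_gt0.
  have e3 : Num.sqrt 3 ^+ 2 = 3 :> R by rewrite sqr_sqrtr.
  have third : Num.sqrt 3%:R^-1 = Num.sqrt 3 / 3 :> R.
    rewrite sqrtrV //; move: r3 e3; set r := Num.sqrt 3 => r3 e3.
    by rewrite -e3; field; rewrite gt_eqF.
  have xa : Num.sqrt 3 / 3 * 2 - t%:R^-1 <= Num.sqrt (2 * (1 - 3%:R^-1) - t%:R^-1) :> R.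
    move: r3 e3; set r := Num.sqrt 3 => r3 e3.
    have r32 : 3 / 2 <= r by nra.
    have h0 : 0 <= r / 3 * 2 - t%:R^-1 by lra.
    rewrite -(ger0_norm h0) -sqrtr_sqr; apply: ler_wsqrtr.
    move: tV tV2; set v := t%:R^-1 => v0 v2; nra.
  have : 2 * lam * (Num.sqrt 3 / 3 + (Num.sqrt 3 / 3 * 2 - t%:R^-1)) <= l.
    by rewrite /l !subr0 third -mulrDr ler_pM2l ?mulr_gt0 // lerD2l.
  apply: le_trans.
  have -> : 2 * lam * (Num.sqrt 3 / 3 + (Num.sqrt 3 / 3 * 2 - t%:R^-1)) =
    2 * lam * Num.sqrt 3 - 2 * lam / t%:R by field; lra.
  by rewrite lerD2l lerN2 ler_pdivrMr; lra.
have /cvg_seqP/(_ (e / 2))[|N HN] := lim; first by rewrite divr_gt0.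
exists (maxn (maxn N N1) 1) => n; rewrite !geq_max => /andP[/andP[n1 n2] n3].
have s0 : 0 < Num.sqrt n%:R :> R by rewrite sqrtr_gt0 ltr0n.
have := HN n n1; rewrite /= ler_norml => /andP[+ _] => h.
have p0 k : 0 < p k by rewrite ltr0n npart_gt0.
have hj : p (n %/ 3) * p ((n - n %/ 3) * 2 - n %/ t) <= 2 * n.+1%:R * A n.
  apply: le_trans (_ : _ <= p (n %/ 3) * (2 * Q (n - n %/ 3))) _; first by rewrite ler_pM2l ?H1.
  by rewrite mulrCA -mulrA ler_pM2l // rect_ge_term // leq_div.
have A0 := rect_gt0 n.
move: hj; rewrite -ler_ln ?posrE ?mulr_gt0 // lnM ?posrE // lnM ?posrE ?mulr_gt0 // lnM ?posrE // => hj.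
apply: le_trans (_ : _ <= (l - e / 2) * Num.sqrt n%:R) _; first by rewrite ler_pM2r //; lra.
rewrite -ler_pdivlMr //; apply: le_trans (_ : _ <= (ln (p (n %/ 3)) +
  ln (p ((n - n %/ 3) * 2 - n %/ t)) - ln n.+1%:R - ln 2) / Num.sqrt n%:R) _.
  by rewrite !mulrBl mulrDl; lra.
by rewrite ler_pM2r ?invr_gt0 //; lra.
Qed.

Lemma ln_npart_upper e : 0 < e -> exists K, forall m,
  p m <= expR ((2 * lam + e) * Num.sqrt m%:R + K).
Proof.
move=> e0; have /cvg_seqP/(_ e e0)[N HN] := ln_npart_lam.
have p0 k : 0 < p k by rewrite ltr0n npart_gt0.
exists (\sum_(k < N.+1) `|ln (p k)|) => m.
rewrite -[leLHS]lnK ?posrE // ler_expR.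
have [mN|Nm] := ltnP m N.+1.
  apply: ler_wpDl; first by rewrite mulr_ge0 ?sqrtr_ge0 // addr_ge0 ?mulr_ge0 // ltW.
  rewrite (bigD1 (Ordinal mN)) //= (le_trans (ler_norm _)) // lerDl.
  exact: sumr_ge0.
apply: ler_wpDr; first exact: sumr_ge0.
have m0 : 0 < Num.sqrt m%:R :> R by rewrite sqrtr_gt0 ltr0n; apply: leq_trans Nm.
rewrite -ler_pdivrMr //; have := HN m (ltnW Nm).
by rewrite ler_norml => /andP[_]; rewrite -/(p m); lra.
Qed.

(** Cauchy-Schwarz with its remainder: (sqrt j, sqrt (n - j)) has length sqrt n,
    and sqrt j + sqrt 2 sqrt (n - j) is sqrt 3 times its component along the
    unit vector (1, sqrt 2) / sqrt 3. *)
Lemma sqrt_pair_bound (n j : nat) (tau : R) : (j <= n)%N -> 0 <= tau -> (0 < n)%N ->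
  tau * Num.sqrt n%:R <= `|Num.sqrt j%:R - Num.sqrt n%:R / Num.sqrt 3| ->
  Num.sqrt j%:R + Num.sqrt ((n - j) * 2)%N%:R <=
    (Num.sqrt 3 - Num.sqrt 3 / 2 * tau ^+ 2) * Num.sqrt n%:R.
Proof.
move=> jn t0 n0; have r3 : 0 < Num.sqrt 3 :> R by rewrite sqrtr_gt0.
have e3 : Num.sqrt 3 ^+ 2 = 3 :> R by rewrite sqr_sqrtr.
have e2 : Num.sqrt 2 ^+ 2 = 2 :> R by rewrite sqr_sqrtr.
rewrite natrM sqrtrM //; set a := Num.sqrt j%:R; set c := Num.sqrt (n - j)%N%:R.
set N := Num.sqrt n%:R.
have N0 : 0 < N by rewrite sqrtr_gt0 ltr0n.
have eq : a ^+ 2 + c ^+ 2 = N ^+ 2 by rewrite !sqr_sqrtr // -natrD subnKC.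
move: r3 e3 e2; set r := Num.sqrt 3; set q := Num.sqrt 2 => r3 e3 e2 h.
have h2 : tau ^+ 2 * N ^+ 2 <= (a - N / r) ^+ 2.
  rewrite -exprMn -[leRHS]real_normK ?num_real // ler_pXn2r ?nnegrE //.
  by rewrite mulr_ge0 // ltW.
rewrite -(ler_pM2r N0).
have -> : (a + c * q) * N = r * N ^+ 2 - r / 2 * ((a - N / r) ^+ 2 + (c - N * q / r) ^+ 2).
  have -> : (a - N / r) ^+ 2 + (c - N * q / r) ^+ 2 =
    (a ^+ 2 + c ^+ 2) + N ^+ 2 * (1 + q ^+ 2) / r ^+ 2 - 2 / r * ((a + c * q) * N).
    by field; rewrite gt_eqF.
  by rewrite eq e2 e3; field; rewrite gt_eqF.
have : 0 <= (c - N * q / r) ^+ 2 by apply: sqr_ge0.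
have r2 : 0 < r / 2 by rewrite divr_gt0.
move=> h4; have := ler_wpM2l (ltW r2) (lerD h2 h4); lra.
Qed.

Lemma npart_ge2_ratio e : 0 < e -> exists N, forall j, (N <= j)%N ->
  `|Num.sqrt j%:R * D j - lam * p j| <= e * p j.
Proof.
move=> e0; have /cvg_seqP/(_ e e0)[N HN] := npart_ratio_lam.
exists N.+1 => -[//|j]; rewrite ltnS => /HN.
have p0 : 0 < p j.+1 by rewrite ltr0n npart_gt0.
have -> : 1 - (npart j)%:R / (npart j.+1)%:R = D j.+1 / p j.+1.
  move: p0; rewrite /p /D npartS natrD => p0; field; rewrite gt_eqF //.
rewrite -(ler_pM2r p0) -{2}(gtr0_norm p0) -normrM mulrBl mulrA divfK //.
by rewrite gt_eqF.
Qed.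

Lemma npart_ge2_le_npart j : D j <= p j.
Proof. by case: j => [|j]; rewrite ler_nat // npartS leq_addl. Qed.

(** When sqrt j is far from sqrt (n / 3) the term p j * w (n - j) is
    exponentially small compared with A n; otherwise D j, which is close to
    lam p j / sqrt j, is close to sqrt 3 lam p j / sqrt n. *)
Lemma rect_increment_approx e : 0 < e -> exists N, forall n, (N <= n)%N ->
  `|conv D w n - Num.sqrt 3 * lam / Num.sqrt n%:R * A n| <= e / Num.sqrt n%:R * A n.
Proof.
move=> e0.
(* The window is |sqrt j - sqrt (n / 3)| < tau sqrt n: inside it tau <= 1/4
   gives sqrt j >= sqrt n / 4, and the other bound makes D j accurate. *)
pose tau := Num.min (4^-1) (e / (32 * lam)).
have tau0 : 0 < tau by rewrite lt_min invr_gt0 ltr0n divr_gt0 ?mulr_gt0.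
have tau4 : tau <= 4^-1 by rewrite ge_min lexx.
have taue : 32 * lam * tau <= e.
  by rewrite mulrC -ler_pdivlMr ?mulr_gt0 // ge_min lexx orbT.
have r3 : 0 < Num.sqrt 3 :> R by rewrite sqrtr_gt0.
have e3 : Num.sqrt 3 ^+ 2 = 3 :> R by rewrite sqr_sqrtr.
have r32 : 3 / 2 <= Num.sqrt 3 :> R by nra.
have r2 : Num.sqrt 3 <= 2 :> R by nra.
(* Outside the window [sqrt_pair_bound] gains 4 kap sqrt n in the exponent, of
   which the errors on ln p and on ln A use at most one kap each. *)
pose kap := lam * Num.sqrt 3 * tau ^+ 2 / 4.
have kap0 : 0 < kap by rewrite divr_gt0 ?mulr_gt0 ?exprn_gt0.
have [K HK] := ln_npart_upper (divr_gt0 kap0 (ltr0Sn _ 1)).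
have [N1 HN1] := ln_rect_lower_bound kap0.
have [N2 HN2] := npart_ge2_ratio (divr_gt0 e0 (ltr0Sn _ 15)).
pose M := (1 + Num.sqrt 3 * lam) * expR (2 * K).
have M0 : 0 < M by rewrite mulr_gt0 ?expR_gt0 // addr_gt0 ?mulr_gt0.
(* Beyond N3, exp (2 kap sqrt n) >= (kap / 2 * sqrt n)^4 outweighs
   M (n + 1) sqrt n. *)
pose N3 := (Num.truncn ((4 * M / (e * (kap / 2) ^+ 4)) ^+ 2)).+1.
exists (maxn (maxn N1 (16 * N2)) (maxn N3 1)) => n.
rewrite !geq_max => /andP[/andP[n1 n2] /andP[n3 n0]].
set N := Num.sqrt n%:R; set r := Num.sqrt 3.
have N0 : 0 < N by rewrite sqrtr_gt0 ltr0n.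
have N1' : 1 <= N by rewrite -sqrtr1 ler_wsqrtr // ler1n.
have NN : N ^+ 2 = n%:R by rewrite sqr_sqrtr.
have A0 := rect_gt0 n.
have p0 k : 0 < p k by rewrite ltr0n npart_gt0.
pose off := (1 + r * lam) * (expR (2 * K) * expR (- (2 * kap * N)) * A n).
have off0 : 0 <= off.
  by rewrite !mulr_ge0 ?expR_ge0 ?addr_ge0 ?mulr_ge0 // ltW.
have term (j : 'I_n.+1) : `|D j - r * lam / N * p j| * w (n - j)%N <=
    e / 2 / N * (p j * w (n - j)%N) + off.
  have jn : (j <= n)%N by rewrite -ltnS.
  have /andP[w0 wp] := splitting_increment_bounds (n - j).
  have in0 : 0 <= e / 2 / N * (p j * w (n - j)%N) by rewrite !mulr_ge0 ?invr_ge0 // ltW.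
  have [near|far] := ltP `|Num.sqrt j%:R - N / r| (tau * N).
    apply: ler_wpDr => //; rewrite mulrA; apply: ler_wpM2r => //.
    move: near; set a := Num.sqrt j%:R; rewrite ltr_norml => /andP[near1 near2].
    have rN : N / 2 <= N / r by rewrite ler_pM2l // lef_pV2 // posrE.
    have a4 : N / 4 <= a.
      by have : tau * N <= 4^-1 * N; [rewrite ler_pM2r | lra].
    have a0 : 0 < a by apply: lt_le_trans a4; rewrite divr_gt0.
    have jN2 : (N2 <= j)%N.
      have : n%:R <= 16 * j%:R :> R.
        rewrite -NN -[j%:R]sqr_sqrtr // -/a.
        have := ler_pM (ltW (divr_gt0 N0 (ltr0Sn _ 3))) (ltW (divr_gt0 N0 (ltr0Sn _ 3))) a4 a4.
        by rewrite !expr2; lra.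
      by rewrite -natrM ler_nat => h; move: n2 h; clear; lia.
    have h1 := HN2 j jN2; rewrite -/a in h1.
    have P0 := p0 j; move: h1 P0; set d := D j; set P := p j => h1 P0.
    rewrite -(ler_pM2l (mulr_gt0 N0 a0)).
    have -> : N * a * (e / 2 / N * P) = a * (e / 2) * P by field; rewrite gt_eqF.
    have -> : N * a * `|d - r * lam / N * P| = `|N * (a * d - lam * P) + lam * P * r * (N / r - a)|.
      rewrite -[N * a](gtr0_norm (mulr_gt0 N0 a0)) -normrM; congr `|_|.
      by field; rewrite !gt_eqF.
    apply: le_trans (ler_normD _ _) _; rewrite !normrM !(gtr0_norm N0) !(gtr0_norm P0) !(gtr0_norm (r3 : 0 < r)) (gtr0_norm lam_gt0).
    have h2 : `|N / r - a| <= tau * N by rewrite distrC ler_norml; lra.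
    have h3 : N * `|a * d - lam * P| <= N * (e / 16 * P) by rewrite ler_pM2l.
    have h4 : lam * P * r * `|N / r - a| <= lam * P * 2 * (tau * N).
      apply: ler_pM => //; first by rewrite !mulr_ge0 // ltW.
      by rewrite ler_pM2l ?mulr_gt0.
    have NP : 0 < N * P by rewrite mulr_gt0.
    have h5 : lam * P * 2 * (tau * N) <= e / 16 * (N * P).
      have -> : lam * P * 2 * (tau * N) = (32 * lam * tau) / 16 * (N * P) by field.
      by rewrite ler_pM2r // ler_pM2r.
    have h6 : e * P * (N / 4) <= e * P * a by rewrite ler_pM2l ?mulr_gt0.
    lra.
  apply: ler_wpDl => //.
  have h1 : `|D j - r * lam / N * p j| <= (1 + r * lam) * p j.
    apply: le_trans (ler_normB _ _) _; rewrite mulrDl mul1r !ger0_norm //; last first.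
      by rewrite !mulr_ge0 ?invr_ge0 // ltW.
    apply: lerD; first exact: npart_ge2_le_npart.
    by rewrite ler_pM2r // ler_pdivrMr // ler_peMr // ltW // mulr_gt0.
  apply: le_trans (ler_wpM2r w0 h1) _; rewrite -mulrA ler_pM2l; last by rewrite addr_gt0 ?mulr_gt0.
  apply: le_trans (ler_wpM2l (ltW (p0 j)) wp) _.
  apply: le_trans (ler_pM (ltW (p0 _)) (ltW (p0 _)) (HK _) (HK _)) _.
  rewrite -[A n]lnK ?posrE // -!expRD ler_expR.
  have h2 := sqrt_pair_bound jn (ltW tau0) n0 far.
  have l0 : 0 < 2 * lam + kap / 2 by rewrite addr_gt0 ?mulr_gt0 // divr_gt0.
  have h3 := ler_wpM2l (ltW l0) h2; rewrite -/N -/r in h3.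
  have h4 := HN1 n n1; rewrite -/N -/r in h4.
  have h5 : (2 * lam + kap / 2) * ((r - r / 2 * tau ^+ 2) * N) <= (2 * lam * r - 3 * kap) * N.
    rewrite mulrA ler_pM2r //.
    have : 0 <= kap / 2 * (r / 2 * tau ^+ 2).
      by rewrite !mulr_ge0 ?sqr_ge0 // ltW.
    have : kap * r <= kap * 2 by rewrite ler_pM2l.
    have : lam * r * tau ^+ 2 = 4 * kap by rewrite /kap -/r; field.
    lra.
  lra.
have -> : conv D w n - r * lam / N * A n = \sum_(j < n.+1) (D j - r * lam / N * p j) * w (n - j)%N.
  rewrite rect_conv_npart /conv mulr_sumr -sumrB; apply: eq_bigr => j _; ring.
apply: le_trans (ler_norm_sum _ _ _) _.
apply: (@le_trans _ _ (\sum_(j < n.+1) (e / 2 / N * (p j * w (n - j)%N) + off))).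
  apply: ler_sum => j _; rewrite normrM [ `|w _|]ger0_norm ?term //.
  by have /andP[] := splitting_increment_bounds (n - j).
rewrite big_split /= -mulr_sumr -/(conv p w n) -rect_conv_npart sumr_const card_ord.
suff : off *+ n.+1 <= e / 2 / N * A n by lra.
have E4 : (kap / 2 * N) ^+ 4 <= expR (2 * kap * N).
  have -> : 2 * kap * N = 4%:R * (kap / 2 * N) by field.
  rewrite expRM_natl ler_pXn2r ?nnegrE ?expR_ge0 //; last first.
    by rewrite !mulr_ge0 // ltW.
  by apply: le_trans (expR_ge1Dx _); rewrite lerDr.
have k40 : 0 < (kap / 2) ^+ 4 by rewrite exprn_gt0 // divr_gt0.
have NM : 4 * M <= e * (kap / 2) ^+ 4 * N.
  rewrite [leRHS]mulrC -ler_pdivrMr ?mulr_gt0 //.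
  apply: le_trans (ler_norm _) _; rewrite -sqrtr_sqr /N; apply: ler_wsqrtr.
  by apply/ltW/(lt_le_trans (truncnS_gt _)); rewrite ler_nat.
have X0 : 0 < expR (- (2 * kap * N)) by apply: expR_gt0.
have -> : off *+ n.+1 = M * expR (- (2 * kap * N)) * n.+1%:R * A n.
  by rewrite /off /M -/r -mulr_natr; ring.
rewrite ler_pM2r // ler_pdivlMr //.
have XE : expR (- (2 * kap * N)) * expR (2 * kap * N) = 1 by rewrite -expRD addNr expR0.
have XE4 : expR (- (2 * kap * N)) * (kap / 2 * N) ^+ 4 <= 1.
  by apply: (@le_trans _ _ (expR (- (2 * kap * N)) * expR (2 * kap * N))); [rewrite ler_pM2l | rewrite XE].
have n1N : n.+1%:R * N <= 2 * N ^+ 3.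
  rewrite -natr1 -NN; have : 1 * N <= N ^+ 2 * N by rewrite ler_pM2r // expr_ge1 // ltW.
  by rewrite -exprSr; lra.
have g1 : M * expR (- (2 * kap * N)) * n.+1%:R * N <= M * expR (- (2 * kap * N)) * (2 * N ^+ 3).
  by rewrite -mulrA ler_pM2l // mulr_gt0.
have g2 : 4 * M * (expR (- (2 * kap * N)) * N ^+ 3) <= e * (kap / 2) ^+ 4 * N * (expR (- (2 * kap * N)) * N ^+ 3).
  by rewrite ler_pM2r // mulr_gt0 // exprn_gt0.
have g3 : e * (kap / 2) ^+ 4 * N * (expR (- (2 * kap * N)) * N ^+ 3) =
   e * (expR (- (2 * kap * N)) * (kap / 2 * N) ^+ 4) by ring.
have g4 := ler_wpM2l (ltW e0) XE4.
lra.
Qed.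

End Concentration.

(** * Fractional parts of slowly growing sequences *)

Section Equidistribution.
Variable R : realType.

Definition frac (t : R) : R := t - (Num.floor t)%:~R.
(** The antiderivative of frac - 1/2 that is 1-periodic and continuous. *)
Definition sawtooth_primitive (t : R) : R := (frac t ^+ 2 - frac t) / 2.
Local Notation G := sawtooth_primitive.

Lemma frac_itv t : 0 <= frac t < 1.
Proof. by rewrite /frac subr_ge0 ltrBlDl ge_floor /= -intrD1 floorD1_gt. Qed.

Lemma sawtooth_primitive_le1 t : `|G t| <= 1.
Proof.
rewrite /sawtooth_primitive; have /andP[] := frac_itv t; set c := frac t => c0 c1.
by rewrite ler_norml; apply/andP; split; nra.
Qed.

(** When no integer separates s from t the error is exactly (t - s)^2; crossing
    one costs at most 2 (t - s) more. *)
Lemma sawtooth_increment s t : 0 <= t - s < 1 ->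
  `|2 * (G t - G s) - (t - s) * (2 * frac t - 1)| <=
    (t - s) ^+ 2 + 2 * (t - s) * (Num.floor t - Num.floor s)%:~R.
Proof.
move=> /andP[d0 d1]; have /andP[a0 a1] := frac_itv s; have /andP[c0 c1] := frac_itv t.
have [JE|JE] : Num.floor t = Num.floor s \/ Num.floor t = Num.floor s + 1.
  have h1 : Num.floor s <= Num.floor t by apply: le_floor; rewrite -subr_ge0.
  have h2 : Num.floor t < Num.floor s + 2.
    rewrite -(ltr_int R) intrD; apply: le_lt_trans (ge_floor t) _.
    by move: a1; rewrite /frac => a1; rewrite -[2%:~R]/(2 : R); lra.
  by lia.
all: rewrite /sawtooth_primitive JE; move: a0 a1 c0 c1; rewrite /frac JE; set m := (Num.floor s).
- rewrite subrr mulr0 addr0; set a := s - _; have -> : t - m%:~R = a + (t - s) by rewrite /a; ring.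
  move: d0 d1; set d := t - s => d0 d1 a0 a1 c0 c1.
  have -> : 2 * (((a + d) ^+ 2 - (a + d)) / 2 - (a ^+ 2 - a) / 2) - d * (2 * (a + d) - 1) = - d ^+ 2 by field.
  by rewrite normrN ger0_norm ?sqr_ge0.
- rewrite addrAC subrr add0r mulr1 intrD; set a := s - _.
  have -> : t - (m%:~R + 1%:~R) = a + (t - s) - 1 by rewrite /a; ring.
  move: d0 d1; set d := t - s => d0 d1 a0 a1 c0 c1.
  rewrite ler_norml; apply/andP; split; nra.
Qed.

(** Summation by parts. *)
Lemma abel_sqrt_bound (g : nat -> R) N : (forall n, `|g n| <= 1) ->
  `|\sum_(n < N) Num.sqrt n.+1%:R * (g n.+1 - g n)| <= 2 * Num.sqrt N%:R.
Proof.
move=> g1; suff H : `|\sum_(n < N) Num.sqrt n.+1%:R * (g n.+1 - g n) - Num.sqrt N%:R * g N|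
   <= Num.sqrt N%:R.
  have h : `|Num.sqrt N%:R * g N| <= Num.sqrt N%:R.
    by rewrite normrM ger0_norm ?sqrtr_ge0 // ler_piMr ?sqrtr_ge0.
  rewrite -[X in `|X|](subrK (Num.sqrt N%:R * g N)); apply: le_trans (ler_normD _ _) _; lra.
elim: N => [|N IH]; first by rewrite big_ord0 sqrtr0 mul0r subrr normr0.
rewrite big_ord_recr /=; move: IH; set S := \sum_(n < N) _; set r := Num.sqrt N%:R; set s := Num.sqrt _.
have rs : r <= s by rewrite ler_sqrt // ler_nat.
move=> IH; have -> : S + s * (g N.+1 - g N) - s * g N.+1 = (S - r * g N) - (s - r) * g N by ring.
apply: le_trans (ler_normB _ _) _.
have h : `|(s - r) * g N| <= s - r.
  by rewrite normrM ger0_norm ?subr_ge0 // ler_piMr ?subr_ge0.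
lra.
Qed.

(** The increment d of f is close to kap / sqrt n, so frac - 1/2 equals sqrt n /
    kap times an increment of the bounded function G, up to a null sequence
    and to the crossings J of integers.  The crossings telescope to an integer
    part, which is o(N), and the main sum is O(sqrt N) by [abel_sqrt_bound]. *)
Lemma mean_frac_cvg (f : nat -> R) (kap : R) : 0 < kap ->
  (fun n => Num.sqrt n.+1%:R * (f n.+1 - f n)) @ \oo --> kap ->
  arithmetic_mean (fun n => frac (f n.+1) - 2^-1) @ \oo --> (0 : R).
Proof.
move=> k0 fk; pose d n := f n.+1 - f n; pose s n : R := Num.sqrt n.+1%:R.
pose J n : R := (Num.floor (f n.+1) - Num.floor (f n))%:~R.
pose h n := frac (f n.+1) - 2^-1.
pose err n := h n - s n / kap * (G (f n.+1) - G (f n)).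
pose r n := Num.max 0 (`|err n| - 2 * J n).
have d0 : d @ \oo --> (0 : R) := cvg0_of_sqrt_mul fk.
have r0 : r @ \oo --> (0 : R).
  pose z n := `|1 - s n * d n / kap| + d n.
  have z0 : z @ \oo --> (0 : R).
    have -> : 0 = `|1 - kap / kap| + 0 :> R by rewrite divff ?gt_eqF // subrr normr0 addr0.
    apply: cvgD d0; apply: cvg_norm; apply: cvgB; first exact: cvg_cst.
    by apply: cvgM fk _; apply: cvg_cst.
  have [N1 HN1] : exists N, forall n, (N <= n)%N -> 0 < s n * d n / kap < 2.
    have /cvg_seqP/(_ (kap / 2))[|N HN] := fk; first by rewrite divr_gt0.
    exists N => n /HN; rewrite ler_norml -/(s n) -/(d n) => /andP[h1 h2].
    by rewrite divr_gt0 ?ltr_pdivrMr //; lra.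
  have /cvg_seqP/(_ (1/2))[|N2 HN2] := d0; first by rewrite divr_gt0.
  have c0 : (fun=> 0 : R) @ \oo --> (0 : R) by exact: cvg_cst.
  apply: (squeeze_cvgr _ c0 z0).
  exists (maxn N1 N2) => // n /=; rewrite geq_max => /andP[n1 n2].
  have /andP[w0 w2] := HN1 n n1.
  have s0 : 0 < s n by rewrite sqrt_succ_gt0.
  have dn0 : 0 < d n.
    move: w0; rewrite pmulr_lgt0 ?invr_gt0 // pmulr_rgt0 //.
  have dn1 : d n < 1.
    by have := HN2 n n2; rewrite subr0 => /ler_normlW; lra.
  rewrite /r le_max lexx /= ge_max; apply/andP; split; first by rewrite addr_ge0 // ltW.
  have inc := @sawtooth_increment (f n) (f n.+1).
  move: inc; rewrite -/(d n) ltW // dn1 => /(_ isT).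
  set D := G _ - G _; have -> : 2 * frac (f n.+1) - 1 = 2 * h n by rewrite /h; field.
  rewrite -/(J n) => inc.
  have -> : err n = (1 - s n * d n / kap) * h n - s n / kap * ((2 * D - d n * (2 * h n)) / 2).
    by rewrite /err -/D; field; rewrite gt_eqF.
  have hn : `|h n| <= 1.
    have := frac_itv (f n.+1); rewrite /h => /andP[h1 h2].
    by rewrite ler_norml; apply/andP; split; lra.
  rewrite lerBlDr; apply: le_trans (ler_normB _ _) _; rewrite /z -addrA; apply: lerD.
    by rewrite normrM ler_piMr.
  rewrite normrM [ `|s n / kap|]ger0_norm; last by rewrite divr_ge0 // ltW.
  rewrite normrM [ `|2^-1|]ger0_norm //.
  have sk : 0 < s n / kap by rewrite divr_gt0.
  have Jn : 0 <= d n + 2 * J n.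
    by rewrite -(pmulr_rge0 _ dn0); apply: le_trans (normr_ge0 _) (le_trans inc _); lra.
  have : s n / kap * (`|2 * D - d n * (2 * h n)| / 2) <= s n / kap * ((d n ^+ 2 + 2 * d n * J n) / 2).
    by rewrite ler_pM2l // ler_pM2r.
  have -> : s n / kap * ((d n ^+ 2 + 2 * d n * J n) / 2) = (s n * d n / kap) * ((d n + 2 * J n) / 2).
    by field; rewrite gt_eqF.
  by move=> h1; apply: le_trans h1 _; nra.
have J0 : (fun N => N.+1%:R^-1 * (\sum_(n < N.+1) J n)) @ \oo --> (0 : R).
  have Y0 : (fun N => frac (f N.+1) * harmonic N) @ \oo --> (0 : R).
    have c0 : (fun=> 0 : R) @ \oo --> (0 : R) by exact: cvg_cst.
    apply: (squeeze_cvgr _ c0 (@cvg_harmonic R)); apply: nearW => n.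
    have /andP[h0 h1] := frac_itv (f n.+1).
    by rewrite mulr_ge0 //= ler_piMl // ltW.
  have X0 : (fun N => f N.+1 / Num.sqrt N.+1%:R) @ \oo --> 2 * kap.
    by have := cvg_div_sqrt fk; rewrite -cvg_shiftS.
  have -> : (fun N => N.+1%:R^-1 * (\sum_(n < N.+1) J n)) =
    (fun N => f N.+1 / Num.sqrt N.+1%:R * (Num.sqrt N.+1%:R)^-1 - frac (f N.+1) * harmonic N
        - (Num.floor (f 0%N))%:~R * harmonic N).
    apply/funext => N; have -> : \sum_(n < N.+1) J n = (Num.floor (f N.+1))%:~R - (Num.floor (f 0%N))%:~R.
      elim: N => [|N IH]; first by rewrite big_ord1 /J intrB.
      by rewrite big_ord_recr /= IH /J intrB; ring.
    rewrite /frac -mulrA -invfM -expr2 sqr_sqrtr // /harmonic. rewrite /=; ring.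
  have -> : 0 = 2 * kap * 0 - 0 - (Num.floor (f 0%N))%:~R * 0 :> R by rewrite !mulr0 !subr0.
  apply: cvgB; last by apply: cvgM (@cvg_harmonic R); apply: cvg_cst.
  by apply: cvgB Y0; apply: cvgM X0 (@sqrt_inv_cvg0 R).
have A0 : (fun N => N.+1%:R^-1 * (2 * Num.sqrt N.+1%:R) / kap) @ \oo --> (0 : R).
  have -> : (fun N => N.+1%:R^-1 * (2 * Num.sqrt N.+1%:R) / kap) = (fun N => (2 / kap) * (Num.sqrt N.+1%:R)^-1).
    apply/funext => N; have := sqrt_succ_gt0 R N; rewrite -{2}[N.+1%:R]sqr_sqrtr // => h0.
    by field; rewrite !gt_eqF.
  have -> : 0 = (2 / kap) * 0 by rewrite mulr0.
  by apply: cvgM (@sqrt_inv_cvg0 R); apply: cvg_cst.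
have M0 := cesaro r0.
have B0 : (fun N => arithmetic_mean r N + 2 * (N.+1%:R^-1 * (\sum_(n < N.+1) J n)) +
   N.+1%:R^-1 * (2 * Num.sqrt N.+1%:R) / kap) @ \oo --> (0 : R).
  rewrite [X in _ --> X](_ : 0 = 0 + 2 * 0 + 0 :> R); last by rewrite mulr0 !addr0.
  by apply: cvgD A0; apply: cvgD M0 _; apply: cvgM J0; apply: cvg_cst.
apply/cvg_seqP => e /((cvg_seqP _ _).1 B0) [N HN]; exists N => n /HN.
rewrite !subr0 => /ler_normlW; apply: le_trans.
rewrite /arithmetic_mean /series /= !big_mkord normrM [ `|_^-1|]ger0_norm //.
rewrite mulrCA -mulrA -!mulrDr ler_pM2l ?invr_gt0 //.
have -> : \sum_(i < n.+1) (frac (f i.+1) - 2^-1) = \sum_(i < n.+1) err i +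
    (\sum_(i < n.+1) Num.sqrt i.+1%:R * (G (f i.+1) - G (f i))) / kap.
  rewrite mulr_suml -big_split; apply: eq_bigr => i _ /=; rewrite /err /h /s; ring.
apply: le_trans (ler_normD _ _) _; apply: lerD; last first.
  rewrite normrM [ `|kap^-1|]ger0_norm ?invr_ge0 ?(ltW k0) // ler_pM2r ?invr_gt0 //.
  by apply: (@abel_sqrt_bound (fun i => G (f i))) => i; apply: sawtooth_primitive_le1.
apply: le_trans (ler_norm_sum _ _ _) _; rewrite mulr_sumr -big_split.
by apply: ler_sum => i _ /=; rewrite -lerBlDr /r le_max lexx orbT.
Qed.

End Equidistribution.

(** * Benford law for sequences of square-root exponential growth *)

Section BenfordCriterion.
Variables (R : realType) (b : nat).
Hypothesis b1 : (1 < b)%N.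

Lemma ln_base_gt0 : 0 < ln b%:R :> R.
Proof. by rewrite ln_gt0 // ltr1n. Qed.

Lemma logb_shift_le m n k : (0 < m)%N -> (0 < n)%N ->
  (m * b ^ k <= n)%N = (logb b m%:R + k%:R <= logb b n%:R :> R).
Proof.
move=> m0 n0; have b0 : (0 < b ^ k)%N by rewrite expn_gt0 ltnW.
have l0 := ln_base_gt0.
have -> : logb b m%:R + k%:R = ln (m * b ^ k)%:R / ln b%:R :> R.
  rewrite natrM lnM ?posrE ?ltr0n // natrX lnXn ?ltr0n ?(ltnW b1) // /logb mulrDl.
  by congr (_ + _); rewrite mulrnAl divff ?gt_eqF.
by rewrite /logb ler_pM2r ?invr_gt0 // ler_ln ?posrE ?ltr0n ?muln_gt0 ?m0 // ler_nat.
Qed.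

(** There is at most one k with al <= t - k < be, since be <= al + 1, and the
    difference of integer parts counts it. *)
Lemma prefix_digits_floor f n : digit_string b f -> (string_value b f <= n)%N ->
  (prefix f (digits b n))%:R =
  (Num.floor (logb b n%:R - logb b (string_value b f)%:R : R))%:~R -
  (Num.floor (logb b n%:R - logb b (string_value b f).+1%:R : R))%:~R :> R.
Proof.
move=> fs vn; have v0 := string_value_gt0 b1 fs; have n0 := leq_trans v0 vn.
move: vn v0; set v := string_value b f => vn v0.
set t := logb b n%:R; set al := logb b v%:R; set be := logb b _.
have alt k : (v * b ^ k <= n)%N = (al + k%:R <= t) by exact: logb_shift_le.
have bet k : (v.+1 * b ^ k <= n)%N = (be + k%:R <= t) by exact: logb_shift_le.
have albe : be <= al + 1.
  have h : (v.+1 <= v * b)%N by apply: leq_trans (_ : v * 2 <= _)%N; [lia | rewrite leq_mul2l b1 orbT].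
  have := @logb_shift_le v.+1 (v * b) 0 isT (ltac:(by rewrite muln_gt0 v0 ltnW)).
  rewrite muln1 addr0 h => /esym; rewrite -/be => /le_trans; apply.
  have := @logb_shift_le v (v * b) 1 v0 (ltac:(by rewrite muln_gt0 v0 ltnW)).
  rewrite expn1 leqnn /logb natrM lnM ?posrE ?ltr0n // ?(ltnW b1) // mulrDl divff ?gt_eqF ?ln_base_gt0 //.
have al_be : al < be.
  by rewrite /al /be /logb ltr_pM2r ?invr_gt0 ?ln_base_gt0 // ltr_ln ?posrE ?ltr0n // ltr_nat.
have [/(prefix_digitsP b1 fs n0) [k kE]|nP] := boolP (prefix f _).
  have bk : (0 < b ^ k)%N by rewrite expn_gt0 ltnW.
  have h1 : al + k%:R <= t by rewrite -alt /v -kE leq_divM.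
  have h2 : t < be + k%:R by rewrite ltNge -bet -ltnNge /v -kE ltn_ceil.
  rewrite (@floor_def _ _ (k%:Z)); last by rewrite intrD -!pmulrn; apply/andP; split; lra.
  rewrite (@floor_def _ _ (k%:Z - 1)); last by rewrite subrK intrB -!pmulrn; apply/andP; split; lra.
  by rewrite intrB subKr.
have ge0 : 0 <= t - al by rewrite subr_ge0 -[al]addr0 -(alt 0%N) muln1.
have [k kE] : exists k : nat, Num.floor (t - al) = k.
  by exists `|Num.floor (t - al)|%N; rewrite gez0_abs // floor_ge0.
have : k%:R <= t - al < k%:R + 1.
  by have := ge_floor (t - al); have := floorD1_gt (t - al); rewrite kE intrD -!pmulrn => -> ->.
move=> /andP[h1 h2]; rewrite kE (@floor_def _ _ (k%:Z)) ?subrr //.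
rewrite intrD -!pmulrn; apply/andP; split; last by lra.
rewrite lerBrDl -bet leqNgt; apply/negP => h3; move/negP: nP; apply.
apply/(prefix_digitsP b1 fs n0); exists k; apply/eqP; rewrite -/v eqn_leq.
have bk : (0 < b ^ k)%N by rewrite expn_gt0 ltnW.
by rewrite -ltnS ltn_divLR // h3 leq_divRL // alt; lra.
Qed.

(** The indicator of the leading string is be - al minus a difference of two
    fractional parts, and the means of both tend to 1/2. *)
Theorem benford_of_sqrt_growth (a : nat -> nat) (kap : R) :
  (forall n, (0 < a n)%N) -> 0 < kap ->
  (fun n => Num.sqrt n.+1%:R * (ln (a n.+1)%:R - ln (a n)%:R)) @ \oo --> kap ->
  benford R a b.
Proof.
move=> a0 k0 ak f fs; have l0 := ln_base_gt0.
pose t n : R := logb b (a n)%:R.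
set al := logb b (string_value b f)%:R; set be := logb b _.+1%:R.
have v0 := string_value_gt0 b1 fs.
have tk : (fun n => Num.sqrt n.+1%:R * (t n.+1 - t n)) @ \oo --> kap / ln b%:R.
  have -> : (fun n => Num.sqrt n.+1%:R * (t n.+1 - t n)) =
     (fun n => Num.sqrt n.+1%:R * (ln (a n.+1)%:R - ln (a n)%:R) * (ln b%:R)^-1).
    by apply/funext => n; rewrite /t /logb -mulrBl mulrA.
  by apply: cvgM ak _; apply: cvg_cst.
have kl : 0 < kap / ln b%:R by rewrite divr_gt0.
have large : exists N, forall n, (N <= n)%N -> (string_value b f <= a n)%N.
  have := cvg_div_sqrt tk; set k2 := 2 * _ => /cvg_seqP/(_ (k2 / 2)).
  have k20 : 0 < k2 by rewrite mulr_gt0.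
  case; first by rewrite divr_gt0.
  move=> N HN; exists (maxn N (Num.truncn ((2 * al / k2) ^+ 2)).+1) => n.
  rewrite geq_max => /andP[n1 n2].
  have := @logb_shift_le _ _ 0 v0 (a0 n); rewrite muln1 addr0 -/al => ->.
  have := HN n n1; rewrite ler_norml => /andP[+ _].
  have s0 : 0 < Num.sqrt n%:R :> R by rewrite sqrtr_gt0 ltr0n; apply: leq_trans n2.
  move=> h; have {}h : k2 / 2 <= t n / Num.sqrt n%:R by lra.
  rewrite ler_pdivlMr // in h; apply: le_trans h.
  rewrite -ler_pdivrMl ?divr_gt0 //.
  apply: le_trans (ler_norm _) _; rewrite -sqrtr_sqr ler_sqrt //.
  apply: le_trans (_ : _ <= (Num.truncn ((2 * al / k2) ^+ 2)).+1%:R) _; last by rewrite ler_nat.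
  apply: le_trans (ltW (truncnS_gt _)); rewrite le_eqVlt; apply/orP; left; apply/eqP.
  by congr (_ ^+ 2); field; rewrite gt_eqF.
pose ind n : R := (prefix f (digits b (a n)))%:R.
have mean_frac c : arithmetic_mean (fun n => frac (t n.+1 - c) - 2^-1) @ \oo --> (0 : R).
  apply: (@mean_frac_cvg R (fun n => t n - c)) kl _.
  by under eq_fun do rewrite opprB addrA subrK.
pose w n := ind n.+1 - (be - al) + (frac (t n.+1 - al) - 2^-1) - (frac (t n.+1 - be) - 2^-1).
have w0 : w @ \oo --> (0 : R).
  apply/cvg_seqP => e e0; have [N HN] := large; exists N => n Nn.
  rewrite (_ : w n = 0) ?subrr ?normr0 ?ltW // /w /ind /frac.
  by rewrite prefix_digits_floor ?HN ?leqW // -/al -/be -/(t _); ring.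
have mean : (fun N => N.+1%:R^-1 * \sum_(n < N.+1) ind n.+1) @ \oo --> be - al.
  have -> : (fun N => N.+1%:R^-1 * \sum_(n < N.+1) ind n.+1) =
    (fun N => (be - al) + arithmetic_mean w N - arithmetic_mean (fun n => frac (t n.+1 - al) - 2^-1) N
       + arithmetic_mean (fun n => frac (t n.+1 - be) - 2^-1) N).
    apply/funext => N; rewrite /arithmetic_mean /series /= !big_mkord.
    have -> : be - al = N.+1%:R^-1 * \sum_(n < N.+1) (be - al).
      by rewrite sumr_const card_ord -[(be - al) *+ _]mulr_natl mulrA mulVf ?mul1r // pnatr_eq0.
    rewrite -mulrDr -mulrBr -mulrDr -big_split -sumrB -big_split; congr (_ * _).
    by apply: eq_bigr => i _ /=; rewrite /w; ring.
  rewrite [X in _ --> X](_ : be - al = be - al + 0 - 0 + 0); last by rewrite subr0 !addr0.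
  apply: (@cvgD _ _ _ _ _ _ _ _ _ _ (mean_frac be)).
  apply: (@cvgB _ _ _ _ _ _ _ _ _ _ (mean_frac al)).
  by apply: (@cvgD _ _ _ _ _ _ _ _ _ _ (cesaro w0)); apply: cvg_cst.
apply/cvgrPdist_le => e e0.
have /cvg_seqP/(_ (e / 2))[|N HN] := mean; first by rewrite divr_gt0.
near=> x.
have x1 : N.+1%:R <= x by near: x; apply: nbhs_pinfty_ge; rewrite num_real.
have x2 : 2 / e <= x by near: x; apply: nbhs_pinfty_ge; rewrite num_real.
have x0 : 0 < x by apply: lt_le_trans x1.
rewrite /leading_freq.
have -> : (count (fun n => prefix f (digits b (a n))) (iota 1 (Num.truncn x)))%:R =
   \sum_(n < Num.truncn x) ind n.+1 :> R.
  move: (Num.truncn x) => M.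
  have -> : \sum_(n < M) ind n.+1 = \sum_(n <- iota 0 M) ind n.+1.
    by rewrite -[M in iota 0 M]subn0 -/(index_iota 0 M) big_mkord.
  rewrite -sum1_count natr_sum big_mkcond (iotaDl 1 0) big_map.
  by apply: eq_bigr => i _; rewrite /ind add1n; case: ifP.
have := truncn_itv (ltW x0); have : (N < Num.truncn x)%N by rewrite truncn_ge_nat // ltW.
case: (Num.truncn x) => // M; rewrite ltnS => /HN; set S := \sum_(_ < _) _ => hS /andP[M1 M2].
have M0 : 0 < M.+1%:R :> R by [].
have S0 : 0 <= S by apply: sumr_ge0.
have S1 : S <= M.+1%:R.
  rewrite -[M.+1 in leRHS]card_ord -sumr_const; apply: ler_sum => i _.
  by rewrite /ind; case: prefix.
have -> : be - al - S / x = - (M.+1%:R^-1 * S - (be - al)) + (S / M.+1%:R) * ((x - M.+1%:R) / x).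
  by field; rewrite !gt_eqF.
apply: le_trans (ler_normD _ _) _; rewrite normrN.
have h : `|S / M.+1%:R * ((x - M.+1%:R) / x)| <= e / 2.
  have q1 : S / M.+1%:R <= 1 by rewrite ler_pdivrMr // mul1r.
  have q2 : 0 <= S / M.+1%:R by rewrite divr_ge0.
  have q3 : 0 <= (x - M.+1%:R) / x by rewrite divr_ge0 ?subr_ge0 // ltW.
  rewrite ger0_norm; last exact: mulr_ge0.
  apply: le_trans (ler_piMl q3 q1) _.
  rewrite ler_pdivrMr //; rewrite ler_pdivrMr // in x2.
  by rewrite -[M.+2]addn1 natrD in M2; lra.
lra.
Unshelve. all: by end_near. Qed.

End BenfordCriterion.

Lemma rect_partition_number_ratio (R : realType) : exists2 kap : R, 0 < kap &
  (fun n => Num.sqrt n.+1%:R *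
     (1 - (rect_partition_number 2 n)%:R / (rect_partition_number 2 n.+1)%:R)) @ \oo --> kap.
Proof.
have [lam l0 [npart_lam ln_lam]] := ln_npart_asymp R.
exists (Num.sqrt 3 * lam); first by rewrite mulr_gt0 // sqrtr_gt0.
apply/cvg_seqP => e e0.
have [N HN] := rect_increment_approx l0 npart_lam ln_lam e0.
exists N => n Nn; have := HN n.+1 (leqW Nn).
have s0 := sqrt_succ_gt0 R n; have A0 := rect_gt0 R n.+1.
have := rect_increment R n; move: A0 s0; set s := Num.sqrt n.+1%:R.
set a := (rect_partition_number 2 n)%:R; set b := (rect_partition_number 2 n.+1)%:R.
move=> b0 s0 <- h.
have -> : s * (1 - a / b) - Num.sqrt 3 * lam = (b - a - Num.sqrt 3 * lam / s * b) * (s / b).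
  by field; rewrite !gt_eqF.
have sb : 0 < s / b by rewrite divr_gt0.
rewrite normrM [ `|s / b|]gtr0_norm //; apply: le_trans (ler_wpM2r (ltW sb) h) _.
by rewrite le_eqVlt; apply/orP; left; apply/eqP; field; rewrite !gt_eqF.
Qed.

Theorem theorem3p4 (R : realType) (b : nat) (hb : (2 <= b)%N) :
  benford R (fun n : nat => rect_partition_number 2 n) b.
Proof.
have [kap k0 H] := rect_partition_number_ratio R.
have A0 n : 0 < (rect_partition_number 2 n)%:R :> R by exact: rect_gt0.
apply: (@benford_of_sqrt_growth R b hb _ kap) => // [n|].
  by have := A0 n; rewrite ltr0n.
exact: ln_increment_cvg A0 H.
Qed.
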